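(* The class of mPH distributions is contained in the class of MPH$^\ast$ distributions. That is, for all $d,p\ge 1$, if $X\sim \mathrm{mPH}(\boldsymbol{\pi},\{\boldsymbol{T}_1,\dots,\boldsymbol{T}_d\})$ with $\boldsymbol{\pi}$ of dimension $p$ and $\boldsymbol{T}_1,\dots,\boldsymbol{T}_d$ of dimension $p\times p$, then the distribution of $X$ is an MPH$^\ast$ distribution on the $d$-dimensional positive orthant.
   Context: mPH class. Let $\boldsymbol{\pi}=(\pi_1,\dots,\pi_p)$ be a probability row vector and let $\boldsymbol{T}_1,\dots,\boldsymbol{T}_d$ be real $p\times p$ sub-intensity matrices (nonnegative off-diagonal entries, strictly negative diagonal entries, nonpositive row sums) for which all states $1,\dots,p$ are transient (equivalently, each $\boldsymbol{T}_i$ is invertible). Let $\boldsymbol{e}$ be the column vector of ones in $\mathbb{R}^p$ and $\boldsymbol{t}_i=-\boldsymbol{T}_i\boldsymbol{e}$. For $i=1,\dots,d$ let $(J^{(i)}_t)_{t\ge 0}$ be a time-homogeneous Markov jump process on $\{1,\dots,p,p+1\}$ with $p+1$ absorbing, with transition intensities between the states $1,\dots,p$ given by $\boldsymbol{T}_i$ and intensities of jumping to $p+1$ given by $\boldsymbol{t}_i$. Assume that all the processes start in the same state, $J_0^{(1)}=\dots=J_0^{(d)}=:J_0$ with $\mathbb{P}(J_0=j)=\pi_j$ for $j=1,\dots,p$, and that the $d$ processes are conditionally independent given $J_0$. Put $X_i=\inf\{t>0: J^{(i)}_t=p+1\}$. Then $X=(X_1,\dots,X_d)$ is said to be mPH (multivariate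 phase-type) distributed, written $X\sim \mathrm{mPH}(\boldsymbol{\pi},\mathcal{T})$ with $\mathcal{T}=\{\boldsymbol{T}_1,\dots,\boldsymbol{T}_d\}$ (indexed by $i=1,\dots,d$). MPH$^\ast$ class (Kulkarni). A random vector $X=(X_1,\dots,X_d)$ is MPH$^\ast$ distributed if there exist $q\ge 1$, a time-homogeneous Markov jump process $(J_t)_{t\ge0}$ on $\{1,\dots,q,q+1\}$ with $1,\dots,q$ transient and $q+1$ absorbing, with initial distribution concentrated on $\{1,\dots,q\}$, and a matrix $\boldsymbol{R}=(r_{kj})\in\mathbb{R}^{q\times d}$ of nonnegative reward rates, such that $X$ has the same distribution as the vector with components $\sum_{k=1}^q r_{kj}\int_0^\infty 1\{J_t=k\}\,dt$, $j=1,\dots,d$. *)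

(* Defs.v *)
From HB Require Import structures.
From mathcomp Require Import all_boot all_order all_algebra.
From mathcomp Require Import all_classical all_reals all_analysis.

Set Implicit Arguments.
Unset Strict Implicit.
Unset Printing Implicit Defensive.

Import Order.TTheory GRing.Theory Num.Theory.
Import numFieldNormedType.Exports.

Local Open Scope classical_set_scope.
Local Open Scope ring_scope.

(** Time-homogeneous Markov jump processes on the finite state space ['I_n].
    Processes are functions [J : R -> Omega -> 'I_n] of which only the values
    at times [t >= 0] matter. *)

Section transition_functions.
Context {R : realType} {n : nat}.
Implicit Types (p : R -> 'M[R]_n) (L : 'M[R]_n).

Definition transition_function p : Prop :=
  [/\ forall (t : R) k l, 0 <= t -> 0 <= p t k l,
      forall (t : R) k, 0 <= t -> \sum_l p t k l = 1,
      p 0 = 1%:M &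
      forall s t : R, 0 <= s -> 0 <= t -> p (s + t) = p s *m p t].

(* p h = I + h L + o(h) as h decreases to 0, entrywise *)
Definition has_intensities p L : Prop :=
  forall k l, h^-1 * (p h k l - (k == l)%:R) @[h --> 0^'+] --> L k l.

Definition absorbing L (k : 'I_n) : Prop := forall l, L k l = 0.

(* One-step transition matrix of the embedded chain; a state with exit rate 0
   is held forever. *)
Definition embedded_chain L : 'M[R]_n :=
  \matrix_(k, l) if L k k == 0 then (k == l)%:R
                 else if k == l then 0 else L k l / - L k k.

(* Probability that the discrete chain with transition matrix Q started in k
   enters l at step m.+1, and not at any of the steps 1, ..., m. *)
Fixpoint first_passage (Q : 'M[R]_n) (l : 'I_n) (m : nat) (k : 'I_n) : R :=
  if m is m'.+1 then \sum_(j | j != l) Q k j * first_passage Q l m' j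
  else Q k l.

(* The embedded chain started in k returns to k with probability < 1. *)
Definition transient L (k : 'I_n) : Prop :=
  (\sum_(0 <= m <oo) (first_passage (embedded_chain L) k m k)%:E < 1)%E.

End transition_functions.

Section processes.
Context {R : realType} {dsp : measure_display} {Omega : measurableType dsp}.
Variable P : probability Omega R.

Definition cprob (A B : set Omega) : R := fine (P (A `&` B)) / fine (P B).

(* sigma-algebra generated by the variables J t, for t in D *)
Definition sigma_process n (J : R -> Omega -> 'I_n) (D : set R)
    : set (set Omega) :=
  <<s [set A | exists t k, D t /\ A = J t @^-1` [set k]] >>.

(* Right-continuous paths with left limits for the discrete topology on 'I_n,
   i.e. piecewise constant with finitely many jumps on bounded intervals. *)
Definition jump_path n (x : R -> 'I_n) : Prop :=
  (forall t : R, 0 <= t -> \forall s \near t^'+, x s = x t) /\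
  (forall t : R, 0 < t -> exists k, \forall s \near t^'-, x s = k).

(* Markov property with respect to the natural filtration *)
Definition markov_property n (p : R -> 'M[R]_n) (J : R -> Omega -> 'I_n)
    : Prop :=
  forall (s t : R) k l (A : set Omega), 0 <= s -> 0 <= t ->
    sigma_process J `[0, t] A ->
    P (A `&` J t @^-1` [set k] `&` J (t + s) @^-1` [set l]) =
    (P (A `&` J t @^-1` [set k]) * (p s k l)%:E)%E.

Definition markov_jump_process n (L : 'M[R]_n) (J : R -> Omega -> 'I_n)
    : Prop :=
  [/\ forall (t : R) k, 0 <= t -> measurable (J t @^-1` [set k]),
      forall w, jump_path (J ^~ w) &
      exists p : R -> 'M[R]_n,
        [/\ transition_function p, has_intensities p L &
            markov_property p J]].

Definition conditionally_independent n d (J : 'I_d -> R -> Omega -> 'I_n)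
    (J0 : Omega -> 'I_n) : Prop :=
  forall A : 'I_d -> set Omega,
    (forall i, sigma_process (J i) `[0, +oo[ (A i)) ->
    forall k, P (J0 @^-1` [set k]) != 0%E ->
      cprob (\bigcap_i A i) (J0 @^-1` [set k]) =
      \prod_i cprob (A i) (J0 @^-1` [set k]).

End processes.

(** The p non-absorbing states are [lshift 1 k] with [k : 'I_p], and the
    absorbing state is [cemetery p], the last element of ['I_(p + 1)]. *)

Definition cemetery (p : nat) : 'I_(p + 1) := rshift p ord0.

Section phase_type.
Context {R : realType}.

Definition probability_vector p (a : 'rV[R]_p) : Prop :=
  (forall k, 0 <= a ord0 k) /\ \sum_k a ord0 k = 1.

Definition sub_intensity p (T : 'M[R]_p) : Prop :=
  [/\ forall k l, k != l -> 0 <= T k l,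
      forall k, T k k < 0 &
      forall k, \sum_l T k l <= 0].

Definition exit_rates p (T : 'M[R]_p) : 'cV[R]_p := - (T *m const_mx 1).

Definition absorbed_intensity p (T : 'M[R]_p) : 'M[R]_(p + 1) :=
  block_mx T (exit_rates T) 0 0.

Definition absorption_time p (x : R -> 'I_(p + 1)) : \bar R :=
  ereal_inf [set t%:E | t in [set t | 0 < t /\ x t = cemetery p]].

Definition occupation_time n (x : R -> 'I_n) (k : 'I_n) : \bar R :=
  (\int[lebesgue_measure]_(t in `[0%R, +oo[) (\1_(x @^-1` [set k]) t)%:E)%E.

Definition total_reward q d (r : 'M[R]_(q, d)) (x : R -> 'I_(q + 1))
    (j : 'I_d) : \bar R :=
  (\sum_(k < q) (r k j)%:E * occupation_time x (lshift 1 k))%E.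

(* Absorption times and total rewards take values in \bar R and are almost
   surely finite; in both classes below, Y is a real random vector almost
   surely equal to the vector of these quantities. *)

Definition mPH p d (a : 'rV[R]_p) (T : 'I_d -> 'M[R]_p)
    (mu : probability (d.-tuple R) R) : Prop :=
  [/\ probability_vector a,
      forall i, sub_intensity (T i),
      forall i k, transient (absorbed_intensity (T i)) (lshift 1 k) &
      exists (dsp : measure_display) (Omega : measurableType dsp)
        (P : probability Omega R) (J : 'I_d -> R -> Omega -> 'I_(p + 1))
        (J0 : Omega -> 'I_(p + 1)) (Y : {RV P >-> d.-tuple R}),
      [/\ forall i, markov_jump_process P (absorbed_intensity (T i)) (J i),
          (forall i, J i 0 = J0) /\
          (forall k, P (J0 @^-1` [set lshift 1 k]) = (a ord0 k)%:E),
          conditionally_independent P J J0,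
          {ae P, forall w, forall i,
             (tnth (Y w) i)%:E = absorption_time (fun t => J i t w)} &
          forall B, measurable B -> mu B = distribution P Y B]].

Definition MPHstar d (mu : probability (d.-tuple R) R) : Prop :=
  exists (q : nat) (L : 'M[R]_(q + 1)) (r : 'M[R]_(q, d))
    (dsp : measure_display) (Omega : measurableType dsp)
    (P : probability Omega R) (J : R -> Omega -> 'I_(q + 1))
    (Y : {RV P >-> d.-tuple R}),
  [/\ (0 < q)%N /\ (forall k j, 0 <= r k j),
      (forall k, transient L (lshift 1 k)) /\ absorbing L (cemetery q),
      markov_jump_process P L J /\ P (J 0 @^-1` [set cemetery q]) = 0%E,
      {ae P, forall w, forall j,
         (tnth (Y w) j)%:E = total_reward r (fun t => J t w) j} &
      forall B, measurable B -> mu B = distribution P Y B].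

End phase_type.

(* Main.v *)
(** Run the d processes one after the other, each started from the common
    initial state J_0, which is kept as part of the state: this is one absorbing
    process, and the time it spends in stage i is X_i, path by path on the given
    probability space. What has to be shown is that it is Markov.

    On the time grid of mesh h this is elementary: each stage is observed at
    multiples of h and handed over to the next one at the first grid time at
    which it is dead. A finite path of this discretised process is an
    intersection of events of the separate stages, so conditional independence
    given J_0 and the Markov property of each stage give a Markov chain with
    transition matrix Q_h = I + h L + o(h), with L the block intensity matrix.
    Hand-over delays the discretised process by less than h per stage, so if the
    grid time is read off slightly late, right-continuity makes its state
    eventually equal to that of the concatenated process, for every outcome.
    Since Q_h^N converges to the semigroup of L when N h tends to t, the Markov
    property passes to the limit. *)

Require Import Defs.
From HB Require Import structures.
From mathcomp Require Import all_boot all_order all_algebra.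
From mathcomp Require Import all_classical all_reals all_analysis.
From mathcomp Require Import measurable_realfun ring lra.

Set Implicit Arguments.
Unset Strict Implicit.
Unset Printing Implicit Defensive.

Import Order.TTheory GRing.Theory Num.Theory.
Import numFieldNormedType.Exports.
Local Open Scope classical_set_scope.
Local Open Scope ring_scope.

(** * Stochastic matrices and the semigroup of a generator *)

Section matrix_rows.
Context {R : realType} {n : nat}.
Implicit Types (A B C : 'M[R]_n) (a b c : R).

(** The stages are linked only through J_0, and the law of every later stage depends on it; a state
    that forgot it would not be Markov. In continuous time a hand-over happens at a random time,
    whereas on a grid it is decided by finitely many events, each governed by the Markov property of
    one stage at a fixed time. The transition functions of the stages are given only through the
    semigroup law and their intensities at 0, so Q_h is known only up to o(h). This suffices because
    powers of stochastic matrices are stable in the row-sum norm: N steps multiply a one-step error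
    by at most N, and N h stays bounded. The same estimate constructs the semigroup of L, as the
    limit of (I + h L)^N. Transience rests on the order of the stages: the stage index never
    decreases, so a return to a state takes place inside its stage and has the same probability as
    in that stage alone. *)

Definition row_sum_le A c := forall k, \sum_l `|A k l| <= c.

Definition stochastic A :=
  (forall k l, 0 <= A k l) /\ (forall k, \sum_l A k l = 1).

Lemma row_sum_leW A a b : a <= b -> row_sum_le A a -> row_sum_le A b.
Proof. by move=> ab Aa k; exact: le_trans (Aa k) ab. Qed.

Lemma row_sum_le_entry A c k l : row_sum_le A c -> `|A k l| <= c.
Proof.
move=> /(_ k); apply: le_trans; rewrite (bigD1 l)//= lerDl.
exact: sumr_ge0.
Qed.

Lemma row_sum_leD A B a b :
  row_sum_le A a -> row_sum_le B b -> row_sum_le (A + B) (a + b).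
Proof.
move=> Aa Bb k; apply: le_trans (lerD (Aa k) (Bb k)).
rewrite -big_split; apply: ler_sum => l _.
by rewrite mxE; exact: ler_normD.
Qed.

Lemma row_sum_leN A a : row_sum_le A a -> row_sum_le (- A) a.
Proof.
move=> Aa k; apply: le_trans (Aa k).
by apply: ler_sum => l _; rewrite mxE normrN.
Qed.

Lemma row_sum_leZ A a c : row_sum_le A a -> row_sum_le (c *: A) (`|c| * a).
Proof.
move=> Aa k; apply: le_trans (ler_wpM2l (normr_ge0 c) (Aa k)).
by rewrite mulr_sumr; apply: ler_sum => l _; rewrite mxE normrM.
Qed.

(** [row_sum_le] bounds the operator norm induced by the sup norm on columns, which is
    submultiplicative; stochastic matrices have norm at most 1. *)
Lemma row_sum_leM A B a b : 0 <= b ->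
  row_sum_le A a -> row_sum_le B b -> row_sum_le (A * B) (a * b).
Proof.
move=> b0 Aa Bb k; apply: le_trans (ler_wpM2r b0 (Aa k)).
rewrite mulr_suml.
apply: (@le_trans _ _ (\sum_l \sum_j `|A k j| * `|B j l|)).
  apply: ler_sum => l _; rewrite mxE; apply: le_trans (ler_norm_sum _ _ _) _.
  by apply: ler_sum => j _; rewrite normrM.
rewrite exchange_big; apply: ler_sum => j _.
by rewrite -mulr_sumr; apply: ler_wpM2l.
Qed.

Lemma row_sum_le_exists A : exists2 c, 0 < c & row_sum_le A c.
Proof.
exists (1 + \sum_k \sum_l `|A k l|) => [|k].
  by rewrite ltr_pwDl//; apply: sumr_ge0 => k _; exact: sumr_ge0.
rewrite [X in _ <= 1 + X](bigD1 k)//= addrCA lerDl addr_ge0//.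
by apply: sumr_ge0 => j _; exact: sumr_ge0.
Qed.

Lemma stochastic_row_sum A : stochastic A -> row_sum_le A 1.
Proof.
move=> [A0 A1] k; rewrite -(A1 k).
by apply: ler_sum => l _; rewrite ger0_norm.
Qed.

Lemma stochastic1 : stochastic (1 : 'M[R]_n).
Proof.
split=> [k l|k]; first by rewrite mxE; case: eqP.
rewrite (bigD1 k)//= mxE eqxx big1 ?addr0// => l lk.
by rewrite mxE eq_sym (negPf lk).
Qed.

Lemma stochasticM A B : stochastic A -> stochastic B -> stochastic (A * B).
Proof.
move=> [A0 A1] [B0 B1]; split=> [k l|k].
  by rewrite mxE; apply: sumr_ge0 => j _; rewrite mulr_ge0.
under eq_bigr do rewrite mxE.
rewrite exchange_big /= -(A1 k); apply: eq_bigr => j _.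
by rewrite -mulr_sumr B1 mulr1.
Qed.

Lemma stochasticX A N : stochastic A -> stochastic (A ^+ N).
Proof.
move=> sA; elim: N => [|N IH]; first exact: stochastic1.
by rewrite exprS; exact: stochasticM.
Qed.

(** Telescoping: each factor other than the single difference [A - B] is stochastic, so the error
    grows linearly in [N] and not exponentially. *)
Lemma row_sum_le_exprB A B N e : stochastic A -> stochastic B -> 0 <= e ->
  row_sum_le (A - B) e -> row_sum_le (A ^+ N - B ^+ N) (N%:R * e).
Proof.
move=> sA sB e0 AB; elim: N => [|N IH].
  by rewrite subrr mul0r => k; rewrite big1// => l _; rewrite mxE normr0.
have -> : A ^+ N.+1 - B ^+ N.+1 = (A ^+ N - B ^+ N) * A + B ^+ N * (A - B).
  by rewrite mulrBl mulrBr -!exprSr addrA subrK.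
rewrite -natr1 [X in row_sum_le _ X]mulrDl -[N%:R * e]mulr1.
apply: row_sum_leD; apply: row_sum_leM => //.
  exact: stochastic_row_sum.
exact/stochastic_row_sum/stochasticX.
Qed.

Lemma row_sum_le_exprB1 A N e : stochastic A -> 0 <= e ->
  row_sum_le (A - 1) e -> row_sum_le (A ^+ N - 1) (N%:R * e).
Proof.
move=> sA e0 A1; rewrite -[X in _ - X](expr1n _ N).
by apply: row_sum_le_exprB => //; exact: stochastic1.
Qed.

(** The remainder grows at step N by (A^N - 1)(A - 1), of norm at most N e^2; N^2 e^2 is a
    convenient bound for the sum of these increments. *)
Lemma row_sum_le_expr_taylor A N e : stochastic A -> 0 <= e ->
  row_sum_le (A - 1) e ->
  row_sum_le (A ^+ N - 1 - (A - 1) *+ N) (N%:R ^+ 2 * e ^+ 2).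
Proof.
move=> sA e0 A1; elim: N => [|N IH].
  rewrite subrr mulr0n subr0 => k; rewrite big1 ?expr0n ?mul0r// => l _.
  by rewrite mxE normr0.
have -> : A ^+ N.+1 - 1 - (A - 1) *+ N.+1 =
    (A ^+ N - 1 - (A - 1) *+ N) + (A ^+ N - 1) * (A - 1).
  rewrite mulrSr mulrBr mulr1 mulrBl mul1r -exprSr.
  move: (A ^+ N.+1) (A ^+ N) ((A - 1) *+ N) => U V W.
  by apply/matrixP => k l; rewrite !mxE; ring.
apply: (@row_sum_leW _ (N%:R ^+ 2 * e ^+ 2 + (N%:R * e) * e)).
  rewrite -natr1; have : 0 <= N%:R :> R by [].
  have : 0 <= e ^+ 2 by rewrite exprn_ge0.
  by move: (N%:R) => x; nra.
apply: row_sum_leD => //; apply: row_sum_leM => //.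
exact: row_sum_le_exprB1.
Qed.

Lemma row_sum_le_exprB_dist A N N' e : stochastic A -> 0 <= e ->
  row_sum_le (A - 1) e ->
  row_sum_le (A ^+ N - A ^+ N') (`|N%:R - N'%:R| * e).
Proof.
move=> sA e0 A1.
wlog le : N N' / (N' <= N)%N => [H|].
  have [/H//|/ltnW/H Hr] := leqP N' N.
  by rewrite -opprB distrC; exact: row_sum_leN.
rewrite -(subnK le) natrD addrK ger0_norm// exprD -[X in _ - X]mul1r -mulrBl.
rewrite -[X in row_sum_le _ X]mulr1; apply: row_sum_leM => //.
  exact: row_sum_le_exprB1.
exact/stochastic_row_sum/stochasticX.
Qed.

Lemma cvg_squeeze0 (u v : nat -> R) : (forall i, `|u i| <= v i) ->
  v i @[i --> \oo] --> 0 -> u i @[i --> \oo] --> 0.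
Proof.
move=> uv v0.
apply: (@squeeze_cvgr _ _ _ _ (fun i => - v i) v).
- by apply: nearW => i; rewrite -ler_norml.
- by rewrite -oppr0; exact: cvgN.
- exact: v0.
Qed.

End matrix_rows.

(** The mesh is dyadic so that consecutive approximations compare by squaring. If [c] bounds the row
    sums of [L], then h c = 2^-i <= 1, which keeps 1 + h L nonnegative. *)
Definition grid {R : realType} (c : R) (i : nat) : R := (c * 2 ^+ i)^-1.

Lemma grid_gt0 {R : realType} (c : R) i : 0 < c -> 0 < grid c i.
Proof. by move=> c0; rewrite invr_gt0 mulr_gt0// exprn_gt0. Qed.

Lemma cvg_half0 {R : realType} : (2^-1 : R) ^+ i @[i --> \oo] --> 0.
Proof. by apply: cvg_expr; rewrite ger0_norm// invf_lt1// ltr1n. Qed.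

Lemma grid_cvg0 {R : realType} (c : R) : grid c i @[i --> \oo] --> 0.
Proof.
rewrite (_ : grid c = fun i => c^-1 * 2^-1 ^+ i); last first.
  by apply/funext => i; rewrite /grid invfM exprVn.
by rewrite -(mulr0 c^-1); apply: cvgM; [exact: cvg_cst|exact: cvg_half0].
Qed.

Lemma cvg_sum {R : realType} (I : finType) (u : I -> nat -> R) (v : I -> R) :
  (forall k, u k i @[i --> \oo] --> v k) ->
  \sum_k u k i @[i --> \oo] --> \sum_k v k.
Proof.
by move=> uv; apply: cvg_big => [|k _]; [exact: add_continuous|exact: uv].
Qed.

Lemma cvg_sum0 {R : realType} (I : finType) (u : I -> nat -> R) :
  (forall k, u k i @[i --> \oo] --> 0) -> \sum_k u k i @[i --> \oo] --> 0.
Proof. by move=> /cvg_sum; rewrite big1. Qed.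

(** * The semigroup of a generator as a limit of Euler products *)

Section euler_scheme.
Context {R : realType} {n : nat} (L : 'M[R]_n) (c : R).
Hypotheses (c_gt0 : 0 < c) (Lc : row_sum_le L c).
Hypotheses (Loff : forall k l, k != l -> 0 <= L k l).
Hypothesis Lrow : forall k, \sum_l L k l = 0.

Local Notation h := (grid c).

Definition euler i : 'M[R]_n := 1 + h i *: L.

Let hc i : h i * c = 2^-1 ^+ i.
Proof. by rewrite /grid invfM mulrAC mulVf ?gt_eqF// mul1r exprVn. Qed.

Let h0 i : 0 < h i. Proof. exact: grid_gt0. Qed.

Let half0 i : 0 <= (2^-1 : R) ^+ i. Proof. by rewrite exprn_ge0. Qed.

Let half1 i : (2^-1 : R) ^+ i <= 1.
Proof. by rewrite exprn_ile1// invf_le1// ler1n. Qed.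

Let gridV i : (h i)^-1 = c * 2 ^+ i. Proof. by rewrite /grid invrK. Qed.

Lemma euler_stochastic i : stochastic (euler i).
Proof.
split=> [k l|k].
  rewrite !mxE; case: (eqVneq k l) => [->|kl]; last first.
    by rewrite add0r mulr_ge0 ?Loff// ltW.
  have := row_sum_le_entry l l Lc; rewrite ler_norml => /andP[Lll _].
  rewrite mulr1n -lerBlDl sub0r; apply: le_trans (_ : h i * - c <= _).
    by rewrite mulrN hc lerN2 half1.
  by rewrite ler_pM2l.
under eq_bigr do rewrite !mxE.
rewrite big_split /= -mulr_sumr Lrow mulr0 addr0 (bigD1 k)//= eqxx big1 ?addr0//.
by move=> l lk; rewrite eq_sym (negPf lk).
Qed.

Let eulerB1 i : euler i - 1 = h i *: L.
Proof. by rewrite /euler addrAC subrr add0r. Qed.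

Lemma euler_sub1 i : row_sum_le (euler i - 1) (2^-1 ^+ i).
Proof.
rewrite eulerB1 -hc -{2}(ger0_norm (ltW (h0 i))).
exact: row_sum_leZ.
Qed.

(** Two half steps agree with a full step to first order, so only the Taylor remainder for N = 2 is
    left: 4 times the square of 2^-(i+1). *)
Lemma euler_doubling i :
  row_sum_le (euler i.+1 ^+ 2 - euler i) (2^-1 ^+ i * 2^-1 ^+ i).
Proof.
have := @row_sum_le_expr_taylor _ _ (euler i.+1) 2 _ (euler_stochastic _)
  (half0 i.+1) (euler_sub1 i.+1).
rewrite (_ : _ - _ = euler i.+1 ^+ 2 - euler i).
  apply: row_sum_leW; rewrite [_ ^+ i.+1]exprS; move: (2^-1 ^+ i) => x; lra.
rewrite -addrA -opprD; congr (_ - _).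
rewrite /euler [X in X *+ 2]addrAC subrr add0r; congr (_ + _).
rewrite scalerMnl; congr (_ *: _).
rewrite /grid exprSr mulrA [in LHS]invfM -mulr_natr mulfVK//.
Qed.

Let scheme t i := euler i ^+ Num.truncn (t / h i).

Let scheme_step t i : 0 <= t ->
  row_sum_le (scheme t i.+1 - scheme t i) ((t * c + 1) * 2^-1 ^+ i).
Proof.
move=> t0; rewrite /scheme; set N' := Num.truncn _; set N := Num.truncn _.
have /andP[N1 N2] : N%:R <= t * c * 2 ^+ i < N.+1%:R.
  by rewrite -mulrA -gridV truncn_itv// divr_ge0// ltW.
have /andP[N3 N4] : N'%:R <= t * c * 2 ^+ i * 2 < N'.+1%:R.
  by rewrite -!mulrA -exprSr -gridV truncn_itv// divr_ge0// ltW.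
(* Two sources of error: rounding makes [N'] and [2 * N] differ by at most 2, at a cost of 2^-(i+1)
   each, and the [N <= t c 2^i] doublings cost 4^-i each. *)
have -> : euler i.+1 ^+ N' - euler i ^+ N =
    (euler i.+1 ^+ N' - euler i.+1 ^+ (2 * N)) +
    ((euler i.+1 ^+ 2) ^+ N - euler i ^+ N).
  by rewrite exprM addrA subrK.
apply: (@row_sum_leW _ _ _ (2 * 2^-1 ^+ i.+1 + N%:R * (2^-1 ^+ i * 2^-1 ^+ i))).
  rewrite exprS mulrA mulfV// mul1r mulrDl mul1r addrC lerD2r.
  rewrite mulrA ler_wpM2r//; apply: le_trans (ler_wpM2r (half0 i) N1) _.
  by rewrite exprVn mulfK// expf_neq0.
apply: row_sum_leD; last first.
  apply: row_sum_le_exprB; rewrite ?mulr_ge0//.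
  - exact/stochasticX/euler_stochastic.
  - exact: euler_stochastic.
  - exact: euler_doubling.
apply: row_sum_leW (row_sum_le_exprB_dist _ _ (euler_stochastic i.+1)
  (half0 i.+1) (euler_sub1 i.+1)).
rewrite ler_wpM2r// natrM.
rewrite -[N.+1%:R]natr1 in N2; rewrite -[N'.+1%:R]natr1 in N4.
rewrite ler_norml; move: N1 N2 N3 N4; move: (t * c * 2 ^+ i) N%:R N'%:R => x y z.
by move=> *; apply/andP; split; lra.
Qed.

(** This is exp(t L). With Euler products, one comparison of matrix powers gives both the semigroup
    law and the convergence of any chain with intensities [L]. *)
Definition semigroup t : 'M[R]_n := \matrix_(k, l) limn (fun i => scheme t i k l).

Lemma cvg_scheme t k l : 0 <= t ->
  (fun i => scheme t i k l) @ \oo --> semigroup t k l.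
Proof.
move=> t0; rewrite mxE; set u : nat -> R := fun i => _.
have : cvgn (series (telescope u)).
  apply: (@normed_cvg _ (R^o)).
  apply: (@series_le_cvg _ _ (geometric (t * c + 1) 2^-1)) => [i|i|i|].
  - exact: normr_ge0.
  - by apply: geometric_ge0 => //; rewrite addr_ge0// mulr_ge0// ltW.
  - by have := row_sum_le_entry k l (scheme_step i t0); rewrite !mxE.
  - by apply: is_cvg_geometric_series; rewrite ger0_norm// invf_lt1// ltr1n.
move=> /cvg_ex[v uv]; suff : cvgn u by []; apply/cvg_ex; exists (u 0%N + v).
rewrite [X in X @ _](_ : u = fun i => u 0%N + series (telescope u) i); last first.
  by apply/funext => i; exact: eq_sum_telescope.
by apply: cvgD; [exact: cvg_cst|exact: uv].
Qed.

(** One step of [Q i] differs from an Euler step by [h i * err i] with [err i] tending to 0; about t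
    / h steps are made, so the errors add up to about [t * err i]. The slack [K] in the exponent
    absorbs the rounding of times, each step being worth 2^-i. *)
Lemma cvg_stochastic_semigroup (Q : nat -> 'M[R]_n) (N : nat -> nat) (t K : R) :
  0 <= t -> (forall i, stochastic (Q i)) ->
  (forall k l, (h i)^-1 * (Q i k l - (k == l)%:R) @[i --> \oo] --> L k l) ->
  (forall i, `|(N i)%:R - t / h i| <= K) ->
  forall k l, (Q i ^+ N i) k l @[i --> \oo] --> semigroup t k l.
Proof.
move=> t0 Qst QL NK k l.
pose err i := \sum_k \sum_l `|(h i)^-1 * (Q i k l - (k == l)%:R) - L k l|.
have err0 i : 0 <= err i by apply: sumr_ge0 => ? _; exact: sumr_ge0.
have cvg_err : err i @[i --> \oo] --> 0.
  apply: cvg_sum0 => k'; apply: cvg_sum0 => l'.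
  by apply/norm_cvg0P; rewrite -(subrr (L k' l')); apply: cvgB => //; exact: cvg_cst.
have Qeuler i : row_sum_le (Q i - euler i) (h i * err i).
  move=> k'; rewrite /err [X in h i * X](bigD1 k')//= mulrDr ler_wpDr//.
    by rewrite mulr_ge0 ?(ltW (h0 i))// sumr_ge0// => ? _; rewrite sumr_ge0.
  rewrite mulr_sumr; apply: ler_sum => l' _.
  rewrite -[X in _ <= X * _](ger0_norm (ltW (h0 i))) -normrM mulrBr.
  rewrite mulVKf; last by rewrite gt_eqF.
  by rewrite !mxE opprD addrA.
have K0 : 0 <= K by exact: le_trans (NK 0%N).
(* The first term uses [N i * h i <= t + K * h i]; in the second, [K] is raised by 1 for the
   truncation in [scheme]. *)
pose bnd i := (t + K * h i) * err i + (K + 1) * 2^-1 ^+ i.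
have Qscheme i : `|(Q i ^+ N i) k l - scheme t i k l| <= bnd i.
  have -> : (Q i ^+ N i) k l - scheme t i k l =
      (Q i ^+ N i - euler i ^+ N i + (euler i ^+ N i - scheme t i)) k l.
    by rewrite addrA subrK !mxE.
  apply: row_sum_le_entry; apply: row_sum_leD.
    apply: row_sum_leW (row_sum_le_exprB (N i) (Qst i) (euler_stochastic i) _
      (Qeuler i)); last by rewrite mulr_ge0// ltW.
    rewrite mulrA ler_wpM2r// -ler_pdivlMr// mulrDl mulfK ?gt_eqF//.
    by rewrite addrC -lerBlDr (le_trans (ler_norm _)).
  apply: row_sum_leW (row_sum_le_exprB_dist _ _ (euler_stochastic i) (half0 i)
    (euler_sub1 i)).
  rewrite ler_wpM2r//.
  have /truncn_itv/andP[] : 0 <= t / h i by rewrite divr_ge0// ltW.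
  have := NK i; move: (Num.truncn _) => M; rewrite -[M.+1%:R]natr1 !ler_norml.
  by move: (t / _) M%:R (N i)%:R => x y z /andP[? ?] ? ?; apply/andP; split; lra.
have cvg_bnd : bnd i @[i --> \oo] --> 0.
  rewrite (_ : 0 = (t + K * 0) * 0 + (K + 1) * 0); last by rewrite !mulr0 addr0.
  apply: cvgD; last by apply: cvgM; [exact: cvg_cst|exact: cvg_half0].
  apply: cvgM => //; apply: cvgD; first exact: cvg_cst.
  by apply: cvgM; [exact: cvg_cst|exact: grid_cvg0].
rewrite (_ : (fun i => _) =
  fun i => ((Q i ^+ N i) k l - scheme t i k l) + scheme t i k l); last first.
  by apply/funext => i; rewrite subrK.
rewrite -[semigroup t k l]add0r; apply: cvgD; last exact: cvg_scheme.
exact: cvg_squeeze0 Qscheme cvg_bnd.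
Qed.

Let euler_intensity k l :
  (h i)^-1 * (euler i k l - (k == l)%:R) @[i --> \oo] --> L k l.
Proof.
apply: cvg_near_cst; apply: nearW => i.
by rewrite !mxE addrAC subrr add0r mulrA mulVf ?gt_eqF// mul1r.
Qed.

Let cvg_euler (N : nat -> nat) (t K : R) : 0 <= t ->
  (forall i, `|(N i)%:R - t / h i| <= K) ->
  forall k l, (euler i ^+ N i) k l @[i --> \oo] --> semigroup t k l.
Proof.
move=> t0 NK; apply: cvg_stochastic_semigroup NK => //.
by move=> i; exact: euler_stochastic.
Qed.

Let truncn_dist (x : R) : 0 <= x -> `|(Num.truncn x)%:R - x| <= 1.
Proof.
by move=> /truncn_itv; rewrite -natr1 ler_norml => /andP[? ?]; apply/andP; lra.
Qed.

Lemma semigroup_transition : transition_function semigroup.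
Proof.
have th0 t i : 0 <= t -> 0 <= t / h i by move=> t0; rewrite divr_ge0// ltW.
have sst t i : stochastic (scheme t i) by exact/stochasticX/euler_stochastic.
split.
- move=> t k l t0; apply: (cvgr_to_ge (@cvg_scheme t k l t0)).
  by apply: nearW => i; apply: (sst t i).1.
- move=> t k t0.
  have : \sum_l scheme t i k l @[i --> \oo] --> \sum_l semigroup t k l.
    by apply: cvg_sum => l; exact: cvg_scheme.
  move=> /(@cvg_lim _ _ _ _ _) <-//; rewrite (_ : (fun=> _) = fun=> 1).
    by rewrite lim_cst.
  by apply/funext => i; apply: (sst t i).2.
- apply/matrixP => k l; rewrite mxE; apply/cvg_lim => //.
  apply: cvg_near_cst; apply: nearW => i.
  by rewrite /scheme mul0r truncn0 expr0.
- move=> s t s0 t0; apply/matrixP => k l.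
  (* Rounding [s] and [t] separately misses (s + t) / h by at most 2, which the limit does not see,
     and the power splits into a product. *)
  pose N i := (Num.truncn (s / h i) + Num.truncn (t / h i))%N.
  have NK i : `|(N i)%:R - (s + t) / h i| <= 2.
    rewrite natrD mulrDl opprD addrACA.
    by apply: le_trans (ler_normD _ _) _; apply: lerD; exact/truncn_dist/th0.
  have := @cvg_euler N _ _ (addr_ge0 s0 t0) NK k l.
  move=> /(@cvg_lim _ _ _ _ _) <-//; apply/cvg_lim => //.
  under eq_fun do rewrite exprD mxE.
  rewrite mxE; apply: cvg_sum => j.
  by apply: cvgM; exact: cvg_scheme.
Qed.

(** Limit of the Taylor bound for Euler powers, where N 2^-i = N h c <= t c. As the remainder is
    quadratic in [t], division by [t] gives the intensities. *)
Lemma semigroup_taylor t k l : 0 <= t ->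
  `|semigroup t k l - (k == l)%:R - t * L k l| <= t ^+ 2 * c ^+ 2.
Proof.
move=> t0.
have th0 i : 0 <= t / h i by rewrite divr_ge0// ltW.
pose r i := h i * (Num.truncn (t / h i))%:R.
have rt : r i @[i --> \oo] --> t.
  rewrite (_ : r = fun i => h i * ((Num.truncn (t / h i))%:R - t / h i) + t).
    rewrite -[X in _ --> X]add0r; apply: cvgD; last exact: cvg_cst.
    apply: (@cvg_squeeze0 _ _ h) (grid_cvg0 c) => i.
    rewrite normrM gtr0_norm// -[leRHS]mulr1 ler_pM2l//.
    exact: truncn_dist.
  by apply/funext => i; rewrite mulrBr [h i * (t / _)]mulrCA mulfV ?gt_eqF// mulr1 subrK.
have lhs : `|scheme t i k l - (k == l)%:R - r i * L k l| @[i --> \oo] -->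
    `|semigroup t k l - (k == l)%:R - t * L k l|.
  apply: cvg_norm; apply: cvgB; last by apply: cvgM => //; exact: cvg_cst.
  by apply: cvgB; [exact: cvg_scheme|exact: cvg_cst].
apply: (cvgr_to_le lhs); apply: nearW => i.
have := @row_sum_le_expr_taylor _ _ (euler i) (Num.truncn (t / h i)) _
  (euler_stochastic _) (half0 i) (euler_sub1 i).
move=> /row_sum_le_entry - /(_ k l) H.
have -> : scheme t i k l - (k == l)%:R - r i * L k l =
  (scheme t i - 1 - (euler i - 1) *+ Num.truncn (t / h i)) k l.
  by rewrite /r eulerB1 scalerMnl !mxE mulr_natr.
apply: le_trans H _; rewrite -!exprMn -hc.
rewrite ler_pXn2r ?nnegrE ?mulr_ge0 ?(ltW c_gt0) ?(ltW (h0 i))// mulrA ler_pM2r//.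
rewrite -ler_pdivlMr//.
by have /truncn_itv/andP[] := th0 i.
Qed.

Lemma semigroup_intensities : has_intensities semigroup L.
Proof.
move=> k l; apply/cvg_at_rightP => u [u0 ucvg].
apply/subr_cvg0; apply: (@cvg_squeeze0 _ _ (fun i => u i * c ^+ 2)).
  move=> i; have := semigroup_taylor k l (ltW (u0 i)).
  move: (semigroup _ _ _ - _) => x; have ui := u0 i.
  have -> : (u i)^-1 * x - L k l = (u i)^-1 * (x - u i * L k l).
    by rewrite mulrBr mulKf// gt_eqF.
  have -> : u i * c ^+ 2 = (u i)^-1 * (u i ^+ 2 * c ^+ 2).
    by rewrite expr2 -!mulrA mulKf// gt_eqF.
  by rewrite normrM gtr0_norm ?invr_gt0// ler_pM2l// invr_gt0.
by rewrite -(mul0r (c ^+ 2)); apply: cvgM => //; exact: cvg_cst.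
Qed.

End euler_scheme.

(** * Absorption times and concatenated paths *)

Section locally_constant.
Context {R : realType} {T : Type}.
Implicit Types (f : R -> T) (t : R).

(** Explicit intervals replace one-sided filters because concatenation shifts time, and intervals
    are shifted by linear arithmetic. *)
Definition right_const f t :=
  exists2 e, 0 < e & forall s, t <= s -> s < t + e -> f s = f t.

Definition left_const f t :=
  exists2 e, 0 < e & exists k, forall s, t - e < s -> s < t -> f s = k.

Lemma right_constP f t :
  (\forall s \near t^'+, f s = f t) <-> right_const f t.
Proof.
split=> [[e /= e0 H]|[e e0 H]].
  exists e => // s; rewrite le_eqVlt => /predU1P[->//|ts] se.
  by apply: H => //=; rewrite distrC ger0_norm ?ltrBlDl// subr_ge0 ltW.
exists e => //= s /= ts t_lt_s; apply: H; first exact: ltW.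
by rewrite -ltrBlDl (le_lt_trans (ler_norm _))// distrC.
Qed.

Lemma left_constP f t :
  (exists k, \forall s \near t^'-, f s = k) <-> left_const f t.
Proof.
split=> [[k [e /= e0 H]]|[e e0 [k H]]].
  exists e => //; exists k => s ts st; apply: H => //=.
  by rewrite ger0_norm ?subr_ge0 ?ltW// ltrBlDr -ltrBlDl.
exists k; exists e => //= s /= ts s_lt_t; apply: H => //.
by rewrite ltrBlDr -ltrBlDl (le_lt_trans (ler_norm _)).
Qed.

End locally_constant.

Lemma jump_path_right (R : realType) n (x : R -> 'I_n) t :
  jump_path x -> 0 <= t -> right_const x t.
Proof. by move=> [xr _] t0; apply/right_constP/xr. Qed.

Lemma jump_path_left (R : realType) n (x : R -> 'I_n) t :
  jump_path x -> 0 < t -> left_const x t.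
Proof. by move=> [_ xl] t0; apply/left_constP/xl. Qed.

Section absorption.
Context {R : realType} {p : nat} (x : R -> 'I_(p + 1)).
Hypotheses (jx : jump_path x) (x0 : x 0 != cemetery p).

Lemma absorption_time_alive s :
  0 <= s -> (s%:E < absorption_time x)%E -> x s != cemetery p.
Proof.
rewrite le_eqVlt => /predU1P[<-//|s0] sx; apply/eqP => xs.
suff : (absorption_time x <= s%:E)%E by rewrite leNgt sx.
by apply: ereal_inf_lbound; exists s.
Qed.

Lemma absorption_time_gt0 : (0 < absorption_time x)%E.
Proof.
have [e e0 xe] := jump_path_right jx (lexx 0).
apply: (@lt_le_trans _ _ e%:E); first by rewrite lte_fin.
apply/ereal_infP => _ [s [s0 xs] <-]; rewrite lee_fin leNgt; apply/negP => se.
by move/eqP: x0; apply; rewrite -xs (xe _ (ltW s0))// add0r.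
Qed.

(** By right-continuity the path is constant on some [u, u + e), which contains a time in the
    cemetery since u is the infimum; hence the infimum is attained. *)
Lemma absorption_time_fin u : absorption_time x = u%:E ->
  0 < u /\ x u = cemetery p.
Proof.
move=> xu; have u0 : 0 < u by have := absorption_time_gt0; rewrite xu lte_fin.
split=> //; have [e e0 xe] := jump_path_right jx (ltW u0).
have : (absorption_time x < (u + e)%:E)%E by rewrite xu lte_fin ltrDl.
move=> /ereal_inf_lt[_ [s [s0 xs] <-]]; rewrite lte_fin => se.
rewrite -xs xe// leNgt; apply/negP => su.
by have := absorption_time_alive (ltW s0); rewrite xu lte_fin xs eqxx => /(_ su).
Qed.

End absorption.

Definition alive p (k : 'I_(p + 1)) : option 'I_p :=
  if fintype.split k is inl k' then Some k' else None.

Lemma alive_lshift p (k : 'I_p) : alive (lshift 1 k) = Some k.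
Proof. by rewrite /alive (unsplitK (inl k)). Qed.

Lemma alive_cemetery p : alive (cemetery p) = None.
Proof. by rewrite /alive (unsplitK (inr ord0)). Qed.

Variant alive_spec p (k : 'I_(p + 1)) : option 'I_p -> bool -> Type :=
  | AliveSome k' of k = lshift 1 k' : alive_spec k (Some k') false
  | AliveNone of k = cemetery p : alive_spec k None true.

Lemma aliveP p (k : 'I_(p + 1)) : alive_spec k (alive k) (k == cemetery p).
Proof.
case: (split_ordP k) => k' ->.
  by rewrite alive_lshift eq_lrshift; constructor.
by rewrite ord1 alive_cemetery eqxx; constructor.
Qed.

Section concatenated_path.
Context {R : realType} {p d : nat}.
Variable (x : 'I_d -> R -> 'I_(p + 1)) (j0 : 'I_(p + 1)).

(** A triple holds the stage, the remembered initial phase and the current phase. A dead initial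
    state, a null event, is sent to [None] so that later statements can hold for every outcome. *)
Definition alive_state (i : 'I_d) (k : 'I_(p + 1)) :
    option ('I_d * 'I_p * 'I_p) :=
  if alive j0 is Some j then
    if alive k is Some k' then Some (i, j, k') else None
  else None.

(* The remaining stages are run one after the other; [Some (i, u)] means that
   stage [i] has been running for [u] units of time. *)
Fixpoint clock (s : seq 'I_d) (t : R) : option ('I_d * R) :=
  if s is i :: s' then
    if (absorption_time (x i) <= t%:E)%E
    then clock s' (t - fine (absorption_time (x i))) else Some (i, t)
  else None.

Definition concat_path (s : seq 'I_d) (t : R) :=
  if clock s t is Some (i, u) then alive_state i (x i u) else None.

(** The pair holds the stages not yet finished and the number of grid steps made in the current one.
    The step that finds a stage dead also puts the next one at local time 0, so the only delay is
    the overshoot past the absorption time. *)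
Definition grid_step (h : R) (a : seq 'I_d * nat) : seq 'I_d * nat :=
  if a.1 is i :: s' then
    if x i (a.2.+1%:R * h) == cemetery p then (s', 0%N) else (a.1, a.2.+1)
  else a.

Definition grid_state (h : R) (a : seq 'I_d * nat) :=
  if a.1 is i :: _ then alive_state i (x i (a.2%:R * h)) else None.

Definition grid_path (s : seq 'I_d) (h : R) (n : nat) :=
  grid_state h (iter n (grid_step h) (s, 0%N)).

Hypothesis jx : forall i, jump_path (x i).
Hypothesis x0 : forall i, x i 0 = j0.
Hypothesis j0_alive : j0 != cemetery p.

Local Notation tau i := (absorption_time (x i)).

Let x0' i : x i 0 != cemetery p. Proof. by rewrite x0. Qed.

Lemma clock_inv s t i u : 0 <= t -> clock s t = Some (i, u) ->
  [/\ i \in s, 0 <= u & (u%:E < tau i)%E].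
Proof.
elim: s t => [//|i' s IH] t t0 /=; case: ifPn => [ti|]; last first.
  by rewrite -ltNge => ti [<- <-]; rewrite mem_head.
move=> /IH[]; last by move=> si ? ?; split=> //; rewrite in_cons si orbT.
rewrite subr_ge0 -lee_fin fineK//; apply/fin_numPlt; apply/andP; split.
  by rewrite (lt_trans _ (absorption_time_gt0 (jx i') (x0' i')))// ltNy0.
by rewrite (le_lt_trans ti)// ltry.
Qed.

Lemma iter_grid_step_nil h m : iter m (grid_step h) ([::], 0%N) = ([::], 0%N).
Proof. by elim: m => [//|m IH]; rewrite iterS IH. Qed.

Lemma iter_grid_step_alive h i s m :
  (forall m', (0 < m' <= m)%N -> x i (m'%:R * h) != cemetery p) ->
  iter m (grid_step h) (i :: s, 0%N) = (i :: s, m).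
Proof.
elim: m => [//|m IH] alive; rewrite iterS IH/=; last first.
  by move=> m' /andP[m0 mm]; apply: alive; rewrite m0 ltnW.
by rewrite /grid_step /= (negPf (alive m.+1 _))// leqnn.
Qed.

Lemma iter_grid_step_dead h i s m : x i (m.+1%:R * h) = cemetery p ->
  (forall m', (0 < m' <= m)%N -> x i (m'%:R * h) != cemetery p) ->
  iter m.+1 (grid_step h) (i :: s, 0%N) = (s, 0%N).
Proof.
by move=> dead alive; rewrite iterS iter_grid_step_alive// /grid_step /= dead eqxx.
Qed.

(** Each stage is delayed by less than one mesh, so reading [size s] meshes late ensures that the
    local time on the grid is not before the true one; the upper bound brings it within [K * h n],
    where right-continuity applies. After a stage of length u both bounds hold again for t - u and
    one stage fewer, with the same [K]. *)
Lemma cvg_grid_path s (h : nat -> R) (N : nat -> nat) (t K : R) :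
  (forall n, 0 < h n) -> h n @[n --> \oo] --> 0 -> 0 <= t ->
  (forall n, t + (size s)%:R * h n <= (N n)%:R * h n <= t + K * h n) ->
  \forall n \near \oo, grid_path s (h n) (N n) = concat_path s t.
Proof.
move=> h0 hcvg; rewrite /grid_path /concat_path.
have small (C e : R) : 0 < e -> \forall n \near \oo, C * h n < e.
  move=> e0; have : C * h n @[n --> \oo] --> C * 0.
    by apply: cvgM => //; exact: cvg_cst.
  by rewrite mulr0 => /cvgr_lt; apply.
elim: s N t => [|i s IH] N t t0 NP.
  by apply: nearW => n; rewrite iter_grid_step_nil.
rewrite [clock _ _]/=; case: ifPn => [taut|]; last first.
  (* Stage [i] is still running at [t]: the late reading must stay in the interval where the path is
     constant and also before the absorption time. *)
  rewrite -ltNge => ttau.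
  have [e e0 xe] := jump_path_right (jx i) t0.
  have : exists2 e', 0 < e' & forall r, r < t + e' -> (r%:E < tau i)%E.
    case: (tau i) ttau => [u| |//]; last by move=> _; exists 1 => // r _; rewrite ltry.
    rewrite lte_fin => tu; exists (u - t); first by rewrite subr_gt0.
    by move=> r; rewrite addrCA subrr addr0 lte_fin.
  move=> [e' e'0 He'].
  near=> n; have /andP[N1 N2] := NP n.
  have Kh : K * h n < e by near: n; exact: small.
  have Kh' : K * h n < e' by near: n; exact: small.
  rewrite iter_grid_step_alive ?/grid_state/=.
    rewrite xe//; last by rewrite (le_lt_trans N2)// ltrD2l.
    by apply: le_trans N1; rewrite lerDl mulr_ge0// ltW.
  move=> m /andP[m0 mN]; apply: (absorption_time_alive (x0' i)).
    by rewrite mulr_ge0// ltW.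
  apply: He'; apply: (@le_lt_trans _ _ ((N n)%:R * h n)).
    by rewrite ler_pM2r// ler_nat.
  by rewrite (le_lt_trans N2)// ltrD2l.
have [u tauE] : exists u, tau i = u%:E.
  case: (tau i) taut (absorption_time_gt0 (jx i) (x0' i)) => [u| |]//; by exists u.
have [u0 xu] := absorption_time_fin (jx i) (x0' i) tauE.
have {}taut : u <= t by rewrite -lee_fin -tauE.
rewrite tauE /=.
have [e e0 xe] := jump_path_right (jx i) (ltW u0).
(* The last grid step strictly before [u]: one less than the truncation when [u] is itself a grid
   time, since the stage is then already seen dead at [u]. *)
pose M n := (Num.truncn (u / h n) - (u == (Num.truncn (u / h n))%:R * h n)%R)%N.
have MP n : (M n)%:R * h n < u <= (M n).+1%:R * h n.
  rewrite /M; have /andP[] := truncn_itv (divr_ge0 (ltW u0) (ltW (h0 n))).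
  rewrite ler_pdivlMr// ltr_pdivrMr//; set m := Num.truncn _ => m1 m2.
  have [um|um] := eqVneq u; last by rewrite subn0 lt_neqAle eq_sym um m1 ltW.
  have m0 : (0 < m)%N.
    by rewrite lt0n; apply/eqP => m0; move: u0; rewrite um m0 mul0r ltxx.
  by rewrite subn1 prednK// -um lexx andbT [X in _ < X]um ltr_pM2r// ltr_nat prednK.
have MN n : ((M n).+1 <= N n)%N.
  have /andP[M1 M2] := MP n; have /andP[N1 N2] := NP n.
  rewrite -(ltr_nat R) -(ltr_pM2r (h0 n)) (lt_le_trans M1)//.
  rewrite (le_trans taut)// (le_trans _ N1)// lerDl mulr_ge0// ltW//.
have NP' n : t - u + (size s)%:R * h n <= (N n - (M n).+1)%:R * h n
    <= t - u + K * h n.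
  have /andP[M1 M2] := MP n; have /andP[N1 N2] := NP n.
  rewrite natrB// mulrBl; move: N1 M2; rewrite -[(size _).+1%:R]natr1 -[(M n).+1%:R]natr1.
  by rewrite !mulrDl !mul1r => N1 M2; apply/andP; split; lra.
have tu0 : 0 <= t - u by rewrite subr_ge0.
have {}IH := IH _ _ tu0 NP'.
near=> n.
have <- : grid_state (h n) (iter (N n - (M n).+1) (grid_step (h n)) (s, 0%N)) =
  match clock s (t - u) with
  | Some (i0, u0) => alive_state i0 (x i0 u0)
  | None => None
  end by near: n.
rewrite -{1}(subnK (MN n)) iterD iter_grid_step_dead//.
  have /andP[M1 M2] := MP n; rewrite xe// -natr1 mulrDl mul1r.
  by rewrite ltrD// -[h n]mul1r; near: n; exact: small.
move=> m /andP[m0 mM]; have /andP[M1 M2] := MP n.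
apply: (absorption_time_alive (x0' i)); first by rewrite mulr_ge0// ltW.
by rewrite tauE lte_fin (le_lt_trans _ M1)// ler_pM2r// ler_nat.
Unshelve. all: by end_near. Qed.

End concatenated_path.

(** * One-sided limits of the concatenated path and durations of its stages *)

Section concatenated_path_regularity.
Context {R : realType} {p d : nat}.
Variable (x : 'I_d -> R -> 'I_(p + 1)) (j0 : 'I_(p + 1)).
Hypothesis jx : forall i, jump_path (x i).
Hypothesis x0 : forall i, x i 0 = j0.
Hypothesis j0_alive : j0 != cemetery p.

Local Notation tau i := (absorption_time (x i)).

Let x0' i : x i 0 != cemetery p. Proof. by rewrite x0. Qed.

Lemma concat_path_cons_lt i s t : (t%:E < tau i)%E ->
  concat_path x j0 (i :: s) t = alive_state j0 i (x i t).
Proof. by rewrite /concat_path /= leNgt => ->. Qed.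

Lemma concat_path_cons_ge i s u t : tau i = u%:E -> u <= t ->
  concat_path x j0 (i :: s) t = concat_path x j0 s (t - u).
Proof. by move=> tu ut; rewrite /concat_path /= tu lee_fin ut. Qed.

Let tau_cases i t :
  (t%:E < tau i)%E \/ exists u, [/\ tau i = u%:E, 0 < u & u <= t].
Proof.
have [?|ti] := ltP t%:E (tau i); [by left|right].
case E : (tau i) ti (absorption_time_gt0 (jx i) (x0' i)) => [u| |]//.
by rewrite lee_fin lte_fin; exists u.
Qed.

Let tau_room i t : (t%:E < tau i)%E ->
  exists2 e, 0 < e & forall r, r < t + e -> (r%:E < tau i)%E.
Proof.
case: (tau i) => [u| |//]; last by move=> _; exists 1 => // r _; rewrite ltry.
rewrite lte_fin => tu; exists (u - t); first by rewrite subr_gt0.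
by move=> r; rewrite addrCA subrr addr0 lte_fin.
Qed.

Lemma concat_path_right s t : 0 <= t -> right_const (concat_path x j0 s) t.
Proof.
elim: s t => [|i s IH] t t0; first by exists 1.
have [ttau|[u [tauE u0 ut]]] := tau_cases i t.
  have [e e0 xe] := jump_path_right (jx i) t0; have [e' e'0 He'] := tau_room ttau.
  exists (Num.min e e') => [|r tr]; first by rewrite lt_min e0.
  rewrite -ltrBlDl lt_min !ltrBlDl => /andP[re re'].
  by rewrite (concat_path_cons_lt s (He' _ re')) (concat_path_cons_lt s ttau) xe.
have [|e e0 He] := IH (t - u); first by rewrite subr_ge0.
exists e => // r tr re.
rewrite !(concat_path_cons_ge _ tauE)//; last exact: le_trans tr.
by apply: He; [rewrite lerD2r|rewrite addrAC ltrD2r].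
Qed.

Lemma concat_path_left s t : 0 < t -> left_const (concat_path x j0 s) t.
Proof.
elim: s t => [|i s IH] t t0; first by exists 1 => //; exists None.
(* At the very end of stage [i] the left limit still belongs to that stage, hence the non-strict
   comparison. *)
have [tt|[u [tauE u0]]] : (t%:E <= tau i)%E \/
    exists u, [/\ tau i = u%:E, 0 < u & u < t].
  have [?|ti] := leP t%:E (tau i); [by left|right].
  case E : (tau i) ti (absorption_time_gt0 (jx i) (x0' i)) => [u| |]//.
  by rewrite !lte_fin; exists u.
  have [e e0 [k xe]] := jump_path_left (jx i) t0.
  exists e => //; exists (alive_state j0 i k) => r tr rt.
  rewrite concat_path_cons_lt ?xe//.
  by apply: lt_le_trans tt; rewrite lte_fin.
move=> ut; have [|e e0 [k He]] := IH (t - u); first by rewrite subr_gt0.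
exists (Num.min e (t - u)); first by rewrite lt_min e0 subr_gt0.
exists k => r; rewrite ltrBlDr -ltrBlDl lt_min => /andP[re ru rt].
rewrite (concat_path_cons_ge _ tauE); last by move: ru; lra.
by apply: He; move: re rt; lra.
Qed.

Definition in_stage (i : 'I_d) (s : option ('I_d * 'I_p * 'I_p)) : bool :=
  if s is Some (i', _, _) then i' == i else false.

Lemma concat_path_stageN s i t : 0 <= t -> i \notin s ->
  in_stage i (concat_path x j0 s t) = false.
Proof.
rewrite /concat_path => t0 si; case E : (clock _ _ _) => [[i' u]|//].
have [i's _ _] := clock_inv jx x0 j0_alive t0 E; rewrite /alive_state.
case: alive => // j; case: alive => //= k.
by apply: contraNF si => /eqP <-.
Qed.

(** Stages run back to back, so S is the sum of the absorption times of the stages before [i]; their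
    finiteness ensures that stage [i] starts. *)
Lemma concat_path_stage s i u : (forall i', i' \in s -> tau i' \is a fin_num) ->
  uniq s -> i \in s -> tau i = u%:E ->
  exists2 S, 0 <= S & forall t, 0 <= t ->
    in_stage i (concat_path x j0 s t) = (S <= t < S + u).
Proof.
move=> + + + tauE; have [u0 _] := absorption_time_fin (jx i) (x0' i) tauE.
elim: s => [//|i' s IH] fin /= /andP[i's us]; rewrite in_cons => /predU1P[ii'|si].
  exists 0 => // t t0; rewrite t0 add0r /=; have [tu|ut] := ltP t u; last first.
    by rewrite -ii' (concat_path_cons_ge _ tauE)// concat_path_stageN ?subr_ge0// ii'.
  rewrite -ii' concat_path_cons_lt ?tauE ?lte_fin// /alive_state.
  case: (aliveP j0) j0_alive => // j _ _; case: (aliveP (x i t)) => [k _|xt].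
    by rewrite /= eqxx.
  have := absorption_time_alive (x0' i) t0; rewrite tauE lte_fin xt eqxx.
  by move=> /(_ tu).
have [//|S S0 HS] := IH _ us si.
  by move=> i'' si''; apply: fin; rewrite in_cons si'' orbT.
have /fin i'fin : i' \in i' :: s by rewrite mem_head.
have [v tauE'] : exists v, tau i' = v%:E by exists (fine (tau i')); rewrite fineK.
have [v0 _] := absorption_time_fin (jx i') (x0' i') tauE'.
exists (v + S); first by rewrite addr_ge0// ltW.
move=> t t0; have [vt|tv] := leP v t.
  rewrite (concat_path_cons_ge _ tauE')// HS ?subr_ge0//.
  by rewrite lerBrDl ltrBlDl addrA.
rewrite concat_path_cons_lt ?tauE' ?lte_fin//.
have -> : in_stage i (alive_state j0 i' (x i' t)) = false.
  rewrite /alive_state; case: alive => // j; case: alive => //= k.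
  by apply: contraNF i's => /eqP ->.
by rewrite leNgt (lt_le_trans tv)// lerDl.
Qed.

End concatenated_path_regularity.

(** * The concatenated intensity matrix *)

Section state_encoding.
Variable S : finType.

(** [MPHstar] asks for ordinals with the cemetery last, while the chain is handled on optional
    triples with [None] as cemetery. *)
Definition enc (s : option S) : 'I_(#|S| + 1) :=
  if s is Some x then lshift 1 (enum_rank x) else cemetery #|S|.

Definition dec (a : 'I_(#|S| + 1)) : option S := omap enum_val (alive a).

Lemma encK : cancel enc dec.
Proof.
by case=> [x|]; rewrite /dec /= ?alive_cemetery// alive_lshift /= enum_rankK.
Qed.

Lemma decK : cancel dec enc.
Proof.
by move=> a; rewrite /dec; case: (aliveP a) => [k|] -> //=; rewrite enum_valK.
Qed.

Lemma enc_inj : injective enc. Proof. exact: can_inj encK. Qed.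

Lemma sum_enc (V : nmodType) (F : 'I_(#|S| + 1) -> V) :
  \sum_a F a = \sum_s F (enc s).
Proof. by rewrite (reindex enc)//; exists dec => s _; [exact: encK|exact: decK]. Qed.

End state_encoding.

Lemma sum_option (V : nmodType) (T : finType) (F : option T -> V) :
  \sum_s F s = F None + \sum_x F (Some x).
Proof.
rewrite (bigD1 None)//=; congr (_ + _).
rewrite (reindex_omap Some id); last by case.
by apply: eq_bigl => x; rewrite eqxx.
Qed.

Section concatenated_chain.
Context {R : realType} {p d : nat}.
Notation triple := ('I_d * 'I_p * 'I_p)%type.
Implicit Types (K : 'I_d -> 'M[R]_(p + 1)) (s l : option triple) (z : R).

Definition next_stage (i : 'I_d) : option 'I_d :=
  ohead (drop (index i (enum 'I_d)).+1 (enum 'I_d)).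

Definition entry_state (o : option 'I_d) (j : 'I_p) : option triple :=
  omap (fun i => (i, j, j)) o.

(* [K i] governs stage [i]; where it would enter the cemetery, the next stage
   starts afresh from the remembered initial state. [z] is the entry of the
   overall cemetery with itself: 0 for intensities, 1 for probabilities. *)
Definition concat_kernel K z s l : R :=
  if s is Some (i, j, k) then
    (if l is Some (i', j', k') then
       ((i' == i) && (j' == j))%:R * K i (lshift 1 k) (lshift 1 k') else 0)
    + K i (lshift 1 k) (cemetery p) * (l == entry_state (next_stage i) j)%:R
  else z * (l == None)%:R.

Definition concat_mx K z : 'M[R]_(#|{: triple}| + 1) :=
  \matrix_(a, b) concat_kernel K z (dec a) (dec b).

Lemma concat_mxE K z s l :
  concat_mx K z (enc s) (enc l) = concat_kernel K z s l.
Proof. by rewrite mxE !encK. Qed.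

Lemma index_next_stage i i' : next_stage i = Some i' ->
  (index i (enum 'I_d) < index i' (enum 'I_d))%N.
Proof.
rewrite /next_stage; set e := enum 'I_d => H.
have ue : uniq e by exact: enum_uniq.
move: H; case E : (drop _ _) => [//|i2 r] /= [<-].
have lt : ((index i e).+1 < size e)%N.
  by rewrite ltnNge; apply/negP => /drop_oversize; rewrite E.
have -> : i2 = nth i e (index i e).+1.
  by rewrite -[_.+1]addn0 -nth_drop E.
by rewrite index_uniq.
Qed.

Lemma next_stage_neq i j k k' : entry_state (next_stage i) j != Some (i, k, k').
Proof.
case E : (next_stage i) => [i'|//]; apply/eqP => -[ii' _ _].
by move: (index_next_stage E); rewrite ii' ltnn.
Qed.

(** Only the phases of stage [i] with the same [j] and one entry state can be reached, so the row is
    a copy of a row of [K i]. This reduces row sums and first-passage recursions to a single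
    stage. *)
Lemma sum_concat_kernel K z i j k (F : option triple -> R) :
  \sum_l concat_kernel K z (Some (i, j, k)) l * F l =
  \sum_k' K i (lshift 1 k) (lshift 1 k') * F (Some (i, j, k'))
  + K i (lshift 1 k) (cemetery p) * F (entry_state (next_stage i) j).
Proof.
rewrite /concat_kernel; under eq_bigr do rewrite mulrDl.
rewrite big_split /=; congr (_ + _); last first.
  rewrite (bigD1 (entry_state (next_stage i) j))//= eqxx mulr1 big1 ?addr0//.
  by move=> l /negPf ->; rewrite mulr0 mul0r.
rewrite sum_option /= mul0r add0r.
rewrite (eq_bigr (fun x => ((x.1.1 == i) && (x.1.2 == j))%:R *
   K i (lshift 1 k) (lshift 1 x.2) * F (Some (x.1, x.2)))); last by move=> [[]].
rewrite -(pair_bigA _ (fun y k' => ((y.1 == i) && (y.2 == j))%:R *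
   K i (lshift 1 k) (lshift 1 k') * F (Some (y, k'))))/=.
rewrite (bigD1 (i, j))//= !eqxx [X in _ + X]big1 ?addr0; last first.
  move=> [i' j']; rewrite xpair_eqE => /negPf /= ->.
  by apply: big1 => k' _; rewrite !mul0r.
by apply: eq_bigr => k' _; rewrite mul1r.
Qed.

Lemma concat_mx_row K z i j k :
  \sum_b concat_mx K z (enc (Some (i, j, k))) b =
  \sum_l K i (lshift 1 k) l.
Proof.
rewrite [RHS]big_split_ord big_ord1 sum_enc.
rewrite [LHS](eq_bigr (fun l => concat_kernel K z (Some (i, j, k)) l * 1)); last first.
  by move=> l _; rewrite concat_mxE mulr1.
rewrite (sum_concat_kernel K z i j k (fun=> 1)) mulr1; congr (_ + _).
by apply: eq_bigr => l _; rewrite mulr1.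
Qed.

Lemma concat_mx_row_cemetery K z : \sum_b concat_mx K z (cemetery _) b = z.
Proof.
rewrite sum_enc sum_option (concat_mxE K z None None) /= mulr1.
by rewrite big1 ?addr0// => l _; rewrite (concat_mxE K z None (Some l)) /= mulr0.
Qed.

Lemma concat_mx_stochastic K :
  (forall i, stochastic (K i)) -> stochastic (concat_mx K 1).
Proof.
move=> Kst; split=> [a b|a].
  rewrite mxE /concat_kernel; case: (dec a) => [[[i j] k]|]; last by rewrite mul1r.
  rewrite addr_ge0// ?mulr_ge0 ?(Kst i).1//; case: (dec b) => [[[i' j'] k']|//].
  by rewrite mulr_ge0 ?(Kst i).1.
rewrite -[a]decK; case: (dec a) => [[[i j] k]|].
  by rewrite concat_mx_row (Kst i).2.
exact: concat_mx_row_cemetery.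
Qed.

Lemma concat_mx_row0 K :
  (forall i k, \sum_l K i k l = 0) -> forall a, \sum_b concat_mx K 0 a b = 0.
Proof.
move=> K0 a; rewrite -[a]decK; case: (dec a) => [[[i j] k]|].
  by rewrite concat_mx_row.
exact: concat_mx_row_cemetery.
Qed.

Lemma concat_mx_off K :
  (forall i (k k' : 'I_(p + 1)), k != k' -> 0 <= K i k k') ->
  forall a b, a != b -> 0 <= concat_mx K 0 a b.
Proof.
move=> K0 a b; rewrite -[a]decK -[b]decK concat_mxE (inj_eq (@enc_inj _)).
case: (dec a) => [[[i j] k]|]; last by rewrite /= mul0r.
move=> ab; rewrite /= addr_ge0//; last by rewrite mulr_ge0 ?K0// eq_lrshift.
case: (dec b) ab => [[[i' j'] k']|//] ab.
have [ii'|_] := eqVneq i' i; last by rewrite mul0r.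
have [jj'|_] := eqVneq j' j; last by rewrite mul0r.
rewrite mul1r K0// (inj_eq (@lshift_inj _ _)).
by apply: contraNneq ab => ->; rewrite ii' jj'.
Qed.

(** Here [h n] stands for the inverse of the mesh. A hand-over is never a diagonal entry, so the
    identity is subtracted inside the stage block only, and at the cemetery 1 becomes 0. *)
Lemma concat_mx_intensity K (Q : nat -> 'I_d -> 'M[R]_(p + 1)) (h : nat -> R) :
  (forall i (k k' : 'I_(p + 1)),
    h n * (Q n i k k' - (k == k')%:R) @[n --> \oo] --> K i k k') ->
  forall a b, h n * (concat_mx (Q n) 1 a b - (a == b)%:R) @[n --> \oo] -->
    concat_mx K 0 a b.
Proof.
move=> QK a b; rewrite -[a]decK -[b]decK concat_mxE (inj_eq (@enc_inj _)).
case: (dec a) => [[[i j] k]|]; last first.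
  apply: cvg_near_cst; apply: nearW => n; rewrite concat_mxE /= mul0r mul1r.
  by rewrite [None == _]eq_sym subrr mulr0.
pose e := entry_state (next_stage i) j.
have Kc : h n * (Q n i (lshift 1 k) (cemetery p) * (dec b == e)%:R) @[n --> \oo]
    --> K i (lshift 1 k) (cemetery p) * (dec b == e)%:R.
  have := QK i (lshift 1 k) (cemetery p); rewrite eq_lrshift => H.
  rewrite (_ : (fun _ => _) = fun n =>
    h n * (Q n i (lshift 1 k) (cemetery p) - 0) * (dec b == e)%:R).
    by apply: cvgM => //; exact: cvg_cst.
  by apply/funext => n; rewrite subr0 mulrA.
under eq_fun do rewrite concat_mxE /= addrAC mulrDr.
rewrite /=; apply: cvgD => //.
case: (dec b) => [[[i' j'] k']|]; last first.
  by apply: cvg_near_cst; apply: nearW => n; rewrite subrr mulr0.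
have [[-> ->]|ij] := eqVneq (i', j') (i, j).
  rewrite !eqxx mul1r; under eq_fun do rewrite mul1r.
  have := QK i (lshift 1 k) (lshift 1 k'); rewrite (inj_eq (@lshift_inj _ _)).
  by rewrite (_ : (Some (i, j, k) == Some (i, j, k')) = (k == k'))//=;
    apply/eqP/eqP => [[]|->].
apply: cvg_near_cst; apply: nearW => n.
rewrite xpair_eqE in ij; rewrite (negPf ij) !mul0r.
rewrite (_ : (Some (i, j, k) == Some (i', j', k')) = false) ?subrr ?mulr0//.
by apply: contraNF ij => /eqP[-> -> _]; rewrite !eqxx.
Qed.

End concatenated_chain.

(** * Transience of the concatenated chain *)

Section concatenated_transience.
Context {R : realType} {p d : nat}.
Variable K : 'I_d -> 'M[R]_(p + 1).
Hypothesis Kdiag : forall i (k : 'I_p), K i (lshift 1 k) (lshift 1 k) != 0.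
Hypothesis Kabs : forall i, absorbing (K i) (cemetery p).

(** Hand-over leaves the diagonal unchanged, so division by the exit rates commutes with assembling
    the stages. The zero row of the cemetery becomes an identity row, hence 0 on the left and 1 on
    the right. *)
Lemma embedded_concat :
  embedded_chain (concat_mx K 0) = concat_mx (fun i => embedded_chain (K i)) 1.
Proof.
apply/matrixP => a b; rewrite -[a]decK -[b]decK.
rewrite mxE !concat_mxE !(inj_eq (@enc_inj _)).
case: (dec a) => [[[i j] k]|]; last by rewrite /= !mul0r eqxx mul1r eq_sym.
have -> : concat_kernel K 0 (Some (i, j, k)) (Some (i, j, k)) =
    K i (lshift 1 k) (lshift 1 k).
  by rewrite /= !eqxx mul1r [_ == entry_state _ _]eq_sym
    (negPf (next_stage_neq _ _ _ _)) mulr0 addr0.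
rewrite (negPf (Kdiag i k)) /= !mxE (negPf (Kdiag i k)) eq_lrshift.
case: eqVneq => [<-|ab].
  by rewrite !eqxx [_ == entry_state _ _]eq_sym (negPf (next_stage_neq _ _ _ _))
    !mulr0 addr0 mxE (negPf (Kdiag i k)) eqxx mulr0.
rewrite mulrDl mulrAC; congr (_ + _).
case: (dec b) ab => [[[i' j'] k'] ab|_]; last by rewrite mul0r.
have [ii'|_] := eqVneq i' i; last by rewrite !mul0r.
have [jj'|_] := eqVneq j' j; last by rewrite !mul0r.
rewrite ii' jj' in ab; rewrite mxE (negPf (Kdiag i k)) (inj_eq (@lshift_inj _ _)) -mulrA.
by have [kk'|_] := eqVneq k k'; rewrite // kk' eqxx in ab.
Qed.

Let Q := embedded_chain (concat_mx K 0).

Let later (i : 'I_d) (s : option ('I_d * 'I_p * 'I_p)) : bool :=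
  if s is Some (i', _, _) then (index i (enum 'I_d) < index i' (enum 'I_d))%N
  else true.

Lemma later_entry i i' j : ~~ (index i' (enum 'I_d) < index i (enum 'I_d))%N ->
  later i (entry_state (next_stage i') j).
Proof.
rewrite -leqNgt => ii'; case E : (next_stage i') => [i2|//] /=.
exact: leq_ltn_trans (index_next_stage E).
Qed.

Lemma first_passage0 n (A : 'M[R]_n) l k : first_passage A l 0 k = A k l.
Proof. by []. Qed.

Lemma first_passageS n (A : 'M[R]_n) l m k :
  first_passage A l m.+1 k = \sum_j A k j * ((j != l)%:R * first_passage A l m j).
Proof.
rewrite /= big_mkcond; apply: eq_bigr => j _.
by case: (j != l); rewrite ?mul1r// mul0r mulr0.
Qed.

Lemma first_passage_concat_sum l m i j k :
  first_passage Q l m.+1 (enc (Some (i, j, k))) =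
  \sum_k' embedded_chain (K i) (lshift 1 k) (lshift 1 k') *
    ((enc (Some (i, j, k')) != l)%:R * first_passage Q l m (enc (Some (i, j, k'))))
  + embedded_chain (K i) (lshift 1 k) (cemetery p) *
    ((enc (entry_state (next_stage i) j) != l)%:R *
     first_passage Q l m (enc (entry_state (next_stage i) j))).
Proof.
rewrite first_passageS sum_enc {1}/Q embedded_concat.
under eq_bigr do rewrite concat_mxE.
exact: (sum_concat_kernel _ _ _ _ _
  (fun s => (enc s != l)%:R * first_passage Q l m (enc s))).
Qed.

(** Hand-over strictly raises the stage index and nothing lowers it, so neither a later stage nor
    the cemetery leads back. *)
Lemma first_passage_later i j k m s : later i s ->
  first_passage Q (enc (Some (i, j, k))) m (enc s) = 0.
Proof.
elim: m s => [|m IH] [[[i' j'] k'] ii'|_].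
- rewrite /= in ii'; rewrite first_passage0 /Q embedded_concat concat_mxE /=.
  have [E|_] := eqVneq i i'; first by rewrite E ltnn in ii'.
  rewrite mul0r add0r; case: eqP => [E|_]; last by rewrite mulr0.
  have : later i (entry_state (next_stage i') j').
    by apply: later_entry; rewrite -leqNgt ltnW.
  by rewrite -E /= ltnn.
- by rewrite first_passage0 /Q embedded_concat concat_mxE /= mulr0.
- rewrite first_passage_concat_sum IH ?mulr0 ?addr0.
    by apply: big1 => k2 _; rewrite IH// !mulr0.
  by apply: later_entry; rewrite -leqNgt ltnW.
rewrite first_passageS sum_enc {1}/Q embedded_concat big1// => s _.
rewrite concat_mxE /=; case: eqP => [->|_]; last by rewrite mulr0 mul0r.
by rewrite IH// !mulr0.
Qed.

Lemma first_passage_cemetery i m (k : 'I_p) :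
  first_passage (embedded_chain (K i)) (lshift 1 k) m (cemetery p) = 0.
Proof.
have cem : forall l, embedded_chain (K i) (cemetery p) l = (cemetery p == l)%:R.
  by move=> l; rewrite mxE Kabs eqxx.
elim: m => [|m IH]; first by rewrite /= cem eq_rlshift.
rewrite first_passageS big1// => l _; rewrite cem.
by case: eqVneq => [<-|_]; rewrite ?IH ?mulr0 ?mul0r.
Qed.

(** A path that leaves stage [i] cannot come back, so only paths inside the stage count, with the
    weights of the embedded chain of [K i]. The series defining transience is then the same term by
    term. *)
Lemma first_passage_concat i j k m k' :
  first_passage Q (enc (Some (i, j, k))) m (enc (Some (i, j, k'))) =
  first_passage (embedded_chain (K i)) (lshift 1 k) m (lshift 1 k').
Proof.
elim: m k' => [|m IH] k'.
  rewrite !first_passage0 /Q embedded_concat concat_mxE /= !eqxx mul1r.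
  by rewrite [_ == entry_state _ _]eq_sym (negPf (next_stage_neq _ _ _ _)) mulr0 addr0.
rewrite first_passage_concat_sum first_passageS big_split_ord big_ord1.
rewrite [first_passage _ _ m (rshift _ _)]first_passage_cemetery !mulr0.
rewrite first_passage_later ?mulr0; last by apply: later_entry; rewrite ltnn.
congr (_ + _); apply: eq_bigr => k2 _; rewrite IH; congr (_ * (_%:R * _)).
rewrite (inj_eq (@enc_inj _)) (inj_eq (@lshift_inj _ _)).
by congr (~~ _); apply/eqP/eqP => [[]|->].
Qed.

Lemma transient_concat i j k :
  transient (K i) (lshift 1 k) -> transient (concat_mx K 0) (enc (Some (i, j, k))).
Proof.
by rewrite /transient; under [in X in _ -> X]eq_eseriesr do
  rewrite first_passage_concat.
Qed.

Lemma absorbing_concat : absorbing (concat_mx K 0) (cemetery _).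
Proof. by move=> b; rewrite -[b]decK (concat_mxE K 0 None) /= mul0r. Qed.

End concatenated_transience.

(** * The discretised concatenated process *)

Section event_probabilities.
Context {R : realType} {dsp : measure_display} {Omega : measurableType dsp}.
Variable P : probability Omega R.

Lemma fine_probabilityK A : measurable A -> (fine (P A))%:E = P A.
Proof. by move=> mA; rewrite fineK// fin_num_measure. Qed.

Lemma measure_fibers (S : finType) (f : Omega -> S) A : measurable A ->
  (forall s, measurable (A `&` f @^-1` [set s])) ->
  P A = (\sum_s P (A `&` f @^-1` [set s]))%E.
Proof.
move=> mA mf.
have H (r : seq S) : uniq r ->
    measurable (A `&` [set w | f w \in r]) /\
    P (A `&` [set w | f w \in r]) = (\sum_(s <- r) P (A `&` f @^-1` [set s]))%E.
  elim: r => [_|s r IH /= /andP[sr /IH[mr Pr]]].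
    rewrite (_ : _ `&` _ = set0) ?big_nil ?measure0//.
    by rewrite -subset0 => w [].
  have -> : A `&` [set w | f w \in s :: r] =
      (A `&` f @^-1` [set s]) `|` (A `&` [set w | f w \in r]).
    apply/seteqP; split=> w /=.
      by rewrite in_cons => -[Aw /predU1P[]]; [left|right].
    by move=> [[Aw ->]|[Aw wr]]; rewrite in_cons ?eqxx// wr orbT.
  split; first exact: measurableU.
  rewrite big_cons -Pr; apply: measureU => //.
  by apply/seteqP; split=> // w /= [[_ ->] [_ sr']]; rewrite sr' in sr.
have [_ <-] := H (index_enum S) (index_enum_uniq S).
by congr (P _); apply/seteqP; split=> [w Aw|w []//]; split=> //=; rewrite mem_index_enum.
Qed.

Lemma measurable_eventually (A : nat -> set Omega) (B : set Omega) :
  (forall n, measurable (A n)) ->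
  (forall w, \forall n \near \oo, A n w <-> B w) -> measurable B.
Proof.
move=> mA AB.
rewrite (_ : B = \bigcup_N \bigcap_(n in [set n | (N <= n)%N]) A n).
  by apply: bigcupT_measurable => N; apply: bigcap_measurable => //; exists N => /=.
apply/seteqP; split=> [w Bw|w [N _ Hw]].
  by have [N _ HN] := AB w; exists N => // n /HN ->.
have [M _ HM] := AB w; apply/(HM (maxn N M)); first exact: leq_maxr.
by apply: Hw; exact: leq_maxl.
Qed.

(** [B] is the lower limit of the [A n], and the indicators converge boundedly. Even the
    measurability of the concatenated process, which evaluates paths at random times, comes from
    here. *)
Lemma cvg_measure_eventually (A : nat -> set Omega) (B : set Omega) :
  (forall n, measurable (A n)) ->
  (forall w, \forall n \near \oo, A n w <-> B w) ->
  measurable B /\ fine (P (A n)) @[n --> \oo] --> fine (P B).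
Proof.
move=> mA AB; have mB := measurable_eventually mA AB.
split=> //.
have := @dominated_convergence _ _ R P setT measurableT
  (fun n w => (\1_(A n) w)%:E) (fun w => (\1_B w)%:E) (fun=> 1%E).
case.
- by move=> n; apply/measurable_EFinP; exact: measurable_indic.
- by apply/measurable_EFinP; exact: measurable_indic.
- apply/aeW => w _; apply: cvg_near_cst; near=> n.
  have ABn : A n w <-> B w by near: n; exact: AB.
  rewrite !indicE (_ : (w \in A n) = (w \in B))//.
  by apply/idP/idP; rewrite !inE => /ABn.
- exact: finite_measure_integrable_cst.
- by apply/aeW => w n _; rewrite lee_fin ger0_norm// indicE.
move=> _ _; rewrite integral_indic// setIT => H.
have {}H : P (A n) @[n --> \oo] --> P B.
  by apply: cvg_trans H; apply: near_eq_cvg; apply: nearW => n /=;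
    rewrite integral_indic// setIT.
by apply: fine_cvg; rewrite fine_probabilityK.
Unshelve. all: by end_near. Qed.

End event_probabilities.

Section sigma_process_theory.
Context {R : realType} {dsp : measure_display} {Omega : measurableType dsp}.
Context {n : nat} (J : R -> Omega -> 'I_n).
Implicit Types (A B : set Omega) (D : set R).

Lemma sigma_process_measurable D A :
  (forall t k, 0 <= t -> measurable (J t @^-1` [set k])) -> D `<=` `[0, +oo[ ->
  sigma_process J D A -> measurable A.
Proof.
move=> mJ D0; apply: smallest_sub; first exact: sigma_algebra_measurable.
by move=> _ [t [k [/D0 + ->]]]; rewrite /= in_itv/= andbT => /mJ.
Qed.

Lemma sigma_processT D : sigma_process J D setT.
Proof. exact: (@measurableT _ (g_sigma_algebraType _)). Qed.

Lemma sigma_processI D A B :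
  sigma_process J D A -> sigma_process J D B -> sigma_process J D (A `&` B).
Proof. exact: (@measurableI _ (g_sigma_algebraType _)). Qed.

Lemma sigma_process_sub D D' A :
  D `<=` D' -> sigma_process J D A -> sigma_process J D' A.
Proof.
move=> DD'; apply: sub_sigma_algebra2 => _ [t [k [Dt ->]]].
by exists t, k; split=> //; exact: DD'.
Qed.

Lemma sigma_process_gen D t k : D t -> sigma_process J D (J t @^-1` [set k]).
Proof. by move=> Dt; apply: sub_sigma_algebra; exists t, k. Qed.

End sigma_process_theory.

(** * The Markov chain observed on a grid *)

Section grid_chain.
Context {R : realType} {dsp : measure_display} {Omega : measurableType dsp}.
Variable P : probability Omega R.
Context {p d : nat}.
Variables (J : 'I_d -> R -> Omega -> 'I_(p + 1)) (J0 : Omega -> 'I_(p + 1)).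
Variable pt : 'I_d -> R -> 'M[R]_(p + 1).
Hypothesis mJ : forall i (t : R) k, 0 <= t -> measurable (J i t @^-1` [set k]).
Hypothesis pt_J : forall i, markov_property P (pt i) (J i).
Hypothesis JJ0 : forall i, J i 0 = J0.
Hypothesis Jci : conditionally_independent P J J0.
Hypothesis J0_alive : P (J0 @^-1` [set cemetery p]) = 0%E.
Variable i0 : 'I_d.

Notation state := (option ('I_d * 'I_p * 'I_p)).

Let mJ0 k : measurable (J0 @^-1` [set k]).
Proof. by rewrite -(JJ0 i0); exact: mJ. Qed.

Let msp i t B : sigma_process (J i) `[0, t] B -> measurable B.
Proof.
apply: sigma_process_measurable => [u k|u]; first exact: mJ.
by rewrite /= !in_itv/= andbT => /andP[].
Qed.

Let msp' i B : sigma_process (J i) `[0, +oo[ B -> measurable B.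
Proof. by apply: sigma_process_measurable => [u k|//]; exact: mJ. Qed.

(* Conditioning on [J0] makes the factor of stage [i] the only one affected
   by a step of that stage. *)
Lemma stage_step (B : 'I_d -> set Omega) i j t s k l :
  0 <= t -> 0 <= s ->
  (forall i', sigma_process (J i') `[0, +oo[ (B i')) ->
  sigma_process (J i) `[0, t] (B i) ->
  (forall w, J0 w = j -> B i w -> J i t w = k) ->
  P (J0 @^-1` [set j] `&` \bigcap_i' B i' `&` J i (t + s) @^-1` [set l]) =
  (P (J0 @^-1` [set j] `&` \bigcap_i' B i') * (pt i s k l)%:E)%E.
Proof.
move=> t0 s0 sB sBi Bk; pose C := J0 @^-1` [set j].
pose B' i' := if i' == i then B i `&` J i (t + s) @^-1` [set l] else B i'.
have ts0 : 0 <= t + s by exact: addr_ge0.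
have sB' i' : sigma_process (J i') `[0, +oo[ (B' i').
  rewrite /B'; case: eqVneq => [->|_]; last exact: sB.
  by apply: sigma_processI; [exact: sB|apply: sigma_process_gen; rewrite /= in_itv/= ts0].
have mB : measurable (C `&` \bigcap_i' B i').
  apply: measurableI; first exact: mJ0.
  apply: fin_bigcap_measurable => [|i' _]; first exact: finite_finset.
  exact: (msp' (sB i')).
have mB' : measurable (C `&` \bigcap_i' B' i').
  apply: measurableI; first exact: mJ0.
  apply: fin_bigcap_measurable => [|i' _]; first exact: finite_finset.
  exact: (msp' (sB' i')).
have -> : C `&` \bigcap_i' B i' `&` J i (t + s) @^-1` [set l] =
    C `&` \bigcap_i' B' i'.
  rewrite -setIA; congr (_ `&` _); apply/seteqP; split=> [w [Bw Jw] i' _|w B'w].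
    by rewrite /B'; case: eqVneq => [_|_]; [split => //; exact: Bw|exact: Bw].
  split=> [i' _|]; last by have := B'w i I; rewrite /B' eqxx => -[].
  by have := B'w i' I; rewrite /B'; case: eqVneq => [-> []|].
(* Conditional independence says nothing about an initial state of probability 0; both sides vanish
   then. *)
have [PC|PC] := eqVneq (P C) 0%E.
  have z A : measurable A -> P (C `&` A) = 0%E.
    move=> mA; apply: (@subset_measure0 _ _ _ P _ C) PC; [|exact: mJ0|exact: subIsetl].
    by apply: measurableI => //; exact: mJ0.
  rewrite !z ?mul0e//; apply: fin_bigcap_measurable => [|i' _];
    by [exact: finite_finset|exact: (msp' (sB i'))|exact: (msp' (sB' i'))].
pose c := fine (P C).
have c0 : c != 0 by rewrite /c fine_eq0// fin_num_measure//; exact: mJ0.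
have PE A : cprob P (\bigcap_i' A i') C = \prod_i' cprob P (A i') C ->
    fine (P (C `&` \bigcap_i' A i')) = c * \prod_i' cprob P (A i') C.
  by move=> <-; rewrite /cprob -/c mulrC mulfVK// setIC.
rewrite -(fine_probabilityK P mB) -(fine_probabilityK P mB') -EFinM; congr (_%:E).
rewrite !PE; [|exact: Jci..].
rewrite -mulrA; congr (_ * _).
rewrite [LHS](bigD1 i)//= [in RHS](bigD1 i)//=.
rewrite (eq_bigr (fun i' => cprob P (B i') C)); last first.
  by move=> i' /negPf i'i; rewrite /B' i'i.
suff -> : cprob P (B' i) C = cprob P (B i) C * pt i s k l by ring.
rewrite /B' eqxx /cprob -/c [RHS]mulrAC; congr (_ / _).
(* The initial state is [J i 0], so conditioning on it stays within the past of stage [i]. *)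
have sA : sigma_process (J i) `[0, t] (B i `&` C).
  apply: sigma_processI => //; rewrite /C -(JJ0 i).
  by apply: sigma_process_gen; rewrite /= in_itv/= lexx.
have := @pt_J i s t k l _ s0 t0 sA.
have AE : B i `&` C `&` J i t @^-1` [set k] = B i `&` C.
  by apply/seteqP; split=> [w []//|w [Bw Cw]]; split => //=; apply: Bk.
rewrite AE => E; rewrite setIAC E.
by rewrite -(fine_probabilityK P (msp sA)) -EFinM.
Qed.

Variable h : R.
Hypothesis h_ge0 : 0 <= h.

Let X w : 'I_d -> R -> 'I_(p + 1) := fun i t => J i t w.
Let Z n w : state := grid_path (X w) (J0 w) (enum 'I_d) h n.
Let K i := pt i h.

(* [E] records the initial state and, for every stage entered so far, an event
   of that stage up to its current local time; it determines the clock of the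
   discretised process at step [n] and its state [s]. *)
Definition path_event n (s : state) (E : set Omega) : Prop :=
  exists (j : 'I_p) (r : seq 'I_d) (m : nat) (B : 'I_d -> set Omega),
  [/\ E = J0 @^-1` [set lshift 1 j] `&` \bigcap_i B i,
      forall w, E w -> iter n (grid_step (X w) h) (enum 'I_d, 0%N) = (r, m),
      exists r0, enum 'I_d = r0 ++ r,
      (forall i, sigma_process (J i) `[0, +oo[ (B i)) /\
      (forall i, i \in behead r -> B i = setT) &
      if r is i :: _ then
        exists k, [/\ s = Some (i, j, k),
          sigma_process (J i) `[0, m%:R * h] (B i) &
          forall w, J0 w = lshift 1 j -> B i w ->
            J i (m%:R * h) w = lshift 1 k]
      else s = None].

Lemma path_event_measurable n s E : path_event n s E -> measurable E.
Proof.
move=> [j [r [m [B [-> _ _ [sB _] _]]]]]; apply: measurableI; first exact: mJ0.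
by apply: fin_bigcap_measurable => [|i _]; [exact: finite_finset|exact: (msp' (sB i))].
Qed.

Lemma path_event_state n s E w : path_event n s E -> E w -> Z n w = s.
Proof.
move=> [j [r [m [B [-> run _ _ rs]]]]] Ew; rewrite /Z /grid_path run//.
have [J0w Bw] := Ew; rewrite /grid_state /=; case: r rs {run} => [//|i r].
move=> [k [-> _ Jk]]; rewrite /X Jk//; last exact: Bw.
by rewrite /alive_state J0w !alive_lshift.
Qed.

Lemma next_stage_cat r0 i r : enum 'I_d = r0 ++ i :: r -> next_stage i = ohead r.
Proof.
move=> dE; have := enum_uniq 'I_d; rewrite /next_stage dE cat_uniq.
move=> /and3P[_ /hasPn/= ir0 _]; rewrite index_cat.
have /negPf -> : i \notin r0 by apply: ir0; rewrite mem_head.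
by rewrite /= eqxx addn0 -cat_rcons -(size_rcons r0 i) drop_size_cat.
Qed.

(** While a stage runs, the next state is the image under [tgt] of that stage at its next grid time.
    Since [tgt] is injective, observing the next state amounts to observing that stage, and
    [stage_step] applies; a state outside the range of [tgt] gives the empty event and kernel value
    0. *)
Lemma path_event_step n s E l : path_event n s E ->
  P (E `&` Z n.+1 @^-1` [set l]) =
    (P E * (concat_kernel K 1 s l)%:E)%E /\
  (E `&` Z n.+1 @^-1` [set l] = set0 \/
   path_event n.+1 l (E `&` Z n.+1 @^-1` [set l])).
Proof.
move=> HE; have [j [r [m [B [EE run [r0 dE] [sB BT] rs]]]]] := HE.
case: r run dE rs BT => [|i r] run dE rs BT.
  have Zn w : E w -> Z n.+1 w = None.
    by move=> Ew; rewrite /Z /grid_path iterS run.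
  rewrite rs /concat_kernel mul1r; have [->|lN] := eqVneq l None.
    have -> : E `&` Z n.+1 @^-1` [set None] = E.
      by apply/seteqP; split=> [w []//|w Ew]; split => //; exact: Zn.
    rewrite mule1; split=> //; right; exists j, [::], m, B; split=> //.
      by move=> w Ew; rewrite iterS run.
    by exists r0.
  have -> : E `&` Z n.+1 @^-1` [set l] = set0.
    apply/seteqP; split=> // w [/Zn Zw] /=; rewrite Zw => Nl.
    by rewrite Nl eqxx in lN.
  by rewrite measure0 mule0; split=> //; left.
have [k [sE sBi Bk]] := rs.
have nxt := next_stage_cat dE.
have mh0 : 0 <= m%:R * h by rewrite mulr_ge0.
have mhS : m.+1%:R * h = m%:R * h + h by rewrite -natr1 mulrDl mul1r.
pose tgt (x : 'I_(p + 1)) : state :=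
  if alive x is Some k' then Some (i, j, k') else entry_state (next_stage i) j.
have tgt_inj : injective tgt.
  move=> x y; rewrite /tgt; case: (aliveP x) => [x'|] ->; case: (aliveP y) => [y'|] ->//.
  - by move=> [->].
  - by move=> /eqP; rewrite eq_sym (negPf (next_stage_neq _ _ _ _)).
  - by move=> /eqP; rewrite (negPf (next_stage_neq _ _ _ _)).
have runS w : E w -> iter n.+1 (grid_step (X w) h) (enum 'I_d, 0%N) =
    if J i (m%:R * h + h) w == cemetery p then (r, 0%N) else (i :: r, m.+1).
  by move=> Ew; rewrite iterS run// /grid_step /= mhS.
have Zn w : E w -> Z n.+1 w = tgt (J i (m%:R * h + h) w).
  move=> Ew; rewrite /Z /grid_path runS// /tgt.
  have J0w : J0 w = lshift 1 j by move: Ew; rewrite EE => -[].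
  rewrite /grid_state; case: (aliveP (J i (m%:R * h + h) w)) => [k' Jw|_] /=.
    by rewrite /alive_state J0w alive_lshift mhS /X Jw alive_lshift.
  rewrite nxt; case: (r) => [//|i' r'] /=.
  by rewrite /alive_state mul0r /X JJ0 J0w alive_lshift.
have Ktgt x : concat_kernel K 1 s (tgt x) = K i (lshift 1 k) x.
  rewrite sE /tgt; case: (aliveP x) => [k'|] -> /=.
    rewrite !eqxx mul1r [_ == entry_state _ _]eq_sym.
    by rewrite (negPf (next_stage_neq _ _ _ _)) mulr0 addr0.
  rewrite eqxx mulr1; case En : (next_stage i) => [i'|] /=; last by rewrite add0r.
  have /negPf -> : i' != i.
    by have := index_next_stage En; apply: contraTneq => ->; rewrite ltnn.
  by rewrite mul0r add0r.
have Estep x : E `&` Z n.+1 @^-1` [set tgt x] =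
    E `&` J i (m%:R * h + h) @^-1` [set x].
  apply/seteqP; split=> w [Ew] /=.
    by rewrite Zn// => /tgt_inj.
  by move=> Jw; split=> //=; rewrite Zn// Jw.
have [[x ->]|nx] := pselect (exists x, l = tgt x); last first.
  have -> : E `&` Z n.+1 @^-1` [set l] = set0.
    apply/seteqP; split=> // w [Ew] /=; rewrite Zn// => lE.
    by apply: nx; exists (J i (m%:R * h + h) w).
  rewrite measure0; split; last by left.
  suff -> : concat_kernel K 1 s l = 0 by rewrite mule0.
  rewrite sE /=; case: eqP => [lE|_].
    by case: nx; exists (cemetery p); rewrite /tgt alive_cemetery.
  rewrite mulr0 addr0; case: l nx => [[[i' j'] k']|//] nx.
  have [ii'|_] := eqVneq i' i; last by rewrite mul0r.
  have [jj'|_] := eqVneq j' j; last by rewrite mul0r.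
  by case: nx; exists (lshift 1 k'); rewrite /tgt alive_lshift ii' jj'.
rewrite Estep Ktgt; split.
  by rewrite EE; apply: stage_step Bk.
right; pose B' i' :=
  if i' == i then B i `&` J i (m%:R * h + h) @^-1` [set x] else B i'.
have ir : i \notin r.
  by have := enum_uniq 'I_d; rewrite dE cat_uniq /= => /and4P[].
exists j, (if x == cemetery p then r else i :: r),
  (if x == cemetery p then 0%N else m.+1), B'; split.
- rewrite EE -setIA; congr (_ `&` _); apply/seteqP; split=> [w [Bw Jw] i' _|w B'w].
    by rewrite /B'; case: eqVneq => [_|_]; [split => //; exact: Bw|exact: Bw].
  split=> [i' _|]; last by have := B'w i I; rewrite /B' eqxx => -[].
  by have := B'w i' I; rewrite /B'; case: eqVneq => [-> []|].
- move=> w [Ew Jw]; rewrite runS// (_ : J i (m%:R * h + h) w = x)//.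
  by case: ifP.
- by case: ifP => _; [exists (rcons r0 i); rewrite cat_rcons|exists r0].
- split=> i'.
    rewrite /B'; case: eqVneq => [->|_]; last exact: sB.
    apply: sigma_processI; first exact: sB.
    by apply: sigma_process_gen; rewrite /= in_itv/= addr_ge0.
  move=> i'r; have i'r' : i' \in r by case: ifP i'r => // _ /mem_behead.
  rewrite /B'; case: eqVneq => [ii'|_]; last exact: BT.
  by rewrite -ii' i'r' in ir.
case: (aliveP x) => [k' xE|xE].
  exists k'; split; first by rewrite /tgt xE alive_lshift.
    rewrite mhS /B' eqxx; apply: sigma_processI.
      apply: sigma_process_sub sBi => u /=.
      rewrite !in_itv/= => /andP[-> /le_trans]; apply.
      by rewrite lerDl.
    by apply: sigma_process_gen; rewrite /= in_itv/= lexx addr_ge0.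
  by move=> w _; rewrite /B' eqxx mhS => -[_ /= ->].
rewrite /tgt xE alive_cemetery nxt.
case: (r) ir BT => [//|i' r'] ir BT; exists j => /=.
(* Nothing has been observed of the next stage yet, so its event is known at local time 0, where its
   state is the initial one. *)
have B'i' : B' i' = setT.
  rewrite /B'; case: eqVneq => [ii'|_]; last by apply: BT; rewrite mem_head.
  by rewrite -ii' mem_head in ir.
rewrite B'i'; split=> //; first exact: sigma_processT.
by move=> w J0w _; rewrite mul0r JJ0.
Qed.

(** Path events fix a whole history, whereas the Markov property is tested on constraints at a few
    times. Disjoint unions of histories ending in the same [s] cover these, as the one-step factor
    depends on [s] alone. Outcomes starting in the cemetery have no such history and enter as null
    events. *)
Inductive grid_event n (s : state) : set Omega -> Prop :=
  | grid_event_null E : measurable E -> E `<=` J0 @^-1` [set cemetery p] ->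
      grid_event n s E
  | grid_event_path E : path_event n s E -> grid_event n s E
  | grid_event_union E F : E `&` F = set0 ->
      grid_event n s E -> grid_event n s F -> grid_event n s (E `|` F).

Lemma grid_event_measurable n s E : grid_event n s E -> measurable E.
Proof.
by elim=> [//|{}E /path_event_measurable//|{}E F _ _ mE _ mF]; exact: measurableU.
Qed.

Lemma grid_event_bigcup n s (S : finType) (F : S -> set Omega) :
  (forall x, grid_event n s (F x)) ->
  (forall x y, x != y -> F x `&` F y = set0) ->
  grid_event n s (\bigcup_x F x).
Proof.
move=> FE FI.
have -> : \bigcup_x F x = [set w | exists2 x, x \in index_enum S & F x w].
  apply/seteqP; split=> [w [x _ Fx]|w [x _ Fx]]; last by exists x.
  by exists x => //; rewrite mem_index_enum.
elim: (index_enum S) (index_enum_uniq S) => [_|x r IH /= /andP[xr /IH Er]].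
  rewrite (_ : mkset _ = set0); last by rewrite -subset0 => w [].
  exact: grid_event_null.
have -> : [set w | exists2 y, y \in x :: r & F y w] =
    F x `|` [set w | exists2 y, y \in r & F y w].
  apply/seteqP; split=> w /= => [[y]|[Fx|[y yr Fy]]].
  - by rewrite in_cons => /predU1P[->|yr Fy]; [left|right; exists y].
  - by exists x => //; rewrite mem_head.
  - by exists y => //; rewrite in_cons yr orbT.
apply: grid_event_union => //; rewrite -subset0 => w [Fx [y yr Fy]].
have xy : x != y by apply: contraNneq xr => ->.
by rewrite -(FI _ _ xy).
Qed.

Let Z_cemetery n w : J0 w = cemetery p -> Z n w = None.
Proof.
move=> J0w; rewrite /Z /grid_path /grid_state /alive_state J0w alive_cemetery.
by case: (iter _ _ _).1.
Qed.

Lemma grid_event_step n s E l : grid_event n s E ->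
  P (E `&` Z n.+1 @^-1` [set l]) = (P E * (concat_kernel K 1 s l)%:E)%E /\
  grid_event n.+1 l (E `&` Z n.+1 @^-1` [set l]).
Proof.
elim=> [{}E mE EJ|{}E pE|{}E F EF gE [PE sE] gF [PF sF]].
- have PE0 : P E = 0%E by exact: subset_measure0 EJ J0_alive.
  rewrite PE0 mul0e; have [->|lN] := eqVneq l None.
    have -> : E `&` Z n.+1 @^-1` [set None] = E.
      by apply/seteqP; split=> [w []//|w Ew]; split => //; exact/Z_cemetery/EJ.
    by split=> //; exact: grid_event_null.
  have -> : E `&` Z n.+1 @^-1` [set l] = set0.
    apply/seteqP; split=> // w [/EJ/(Z_cemetery n.+1) Zw] /=; rewrite Zw => Nl.
    by rewrite -Nl eqxx in lN.
  by split; [rewrite measure0|exact: grid_event_null].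
- have [PE [E0|sE]] := path_event_step l pE; split=> //; last exact: grid_event_path.
  by rewrite E0; exact: grid_event_null.
have mE := grid_event_measurable gE; have mF := grid_event_measurable gF.
have EFZ : E `&` Z n.+1 @^-1` [set l] `&` (F `&` Z n.+1 @^-1` [set l]) = set0.
  by rewrite setIACA setIid EF set0I.
rewrite setIUl; split; last exact: grid_event_union.
have -> : P (E `|` F) = (P E + P F)%E by exact: measureU.
rewrite -(fine_probabilityK P mE) -(fine_probabilityK P mF) -EFinD -EFinM mulrDl EFinD !EFinM.
rewrite !fine_probabilityK//.
rewrite -PE -PF; apply: measureU => //.
  exact: (grid_event_measurable sE).
exact: (grid_event_measurable sF).
Qed.

Lemma grid_event_initial s : grid_event 0 s (Z 0 @^-1` [set s]).
Proof.
have i0e : i0 \in enum 'I_d by rewrite mem_enum.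
have Z0 w : Z 0 w = oapp (fun j => omap (fun i => (i, j, j)) (ohead (enum 'I_d)))
    None (alive (J0 w)).
  rewrite /Z /grid_path /grid_state /alive_state /=.
  case: (enum 'I_d) i0e => // i r _ /=; rewrite /X mul0r JJ0.
  by case: (alive (J0 w)).
case E : (enum 'I_d) i0e => [//|i r] _.
have [[j sj]|sN] := pselect (exists j, s = Some (i, j, j)).
  apply: grid_event_path; exists j, (enum 'I_d), 0%N, (fun=> setT); split.
  - rewrite sj; apply/seteqP; split=> w /=; rewrite Z0 E /=.
      by case: (aliveP (J0 w)) => //= j' -> [->].
    by move=> [-> _]; rewrite alive_lshift.
  - by [].
  - by exists [::].
  - by split=> // i'; exact: sigma_processT.
  - rewrite E; exists j; split=> //; first exact: sigma_processT.
    by move=> w J0w _; rewrite mul0r JJ0.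
apply: grid_event_null.
  have [->|sN'] := eqVneq s None.
    rewrite (_ : _ @^-1` _ = J0 @^-1` [set cemetery p]); first exact: mJ0.
    apply/seteqP; split=> w /=; rewrite Z0 E; case: (aliveP (J0 w)) => //= j -> //.
    by move=> /eqP; rewrite eq_lrshift.
  rewrite (_ : _ @^-1` _ = set0)//; rewrite -subset0 => w /=; rewrite Z0 E.
  case: (aliveP (J0 w)) => /= [j _ sE|_ sE]; last by rewrite -sE eqxx in sN'.
  by apply: sN; exists j.
move=> w /=; rewrite Z0 E; case: (aliveP (J0 w)) => //= j _ sE.
by case: sN; exists j.
Qed.

(** [C m] may be everything, so steps may be left free. The induction splits according to the state
    at step n, into finitely many disjoint events. *)
Lemma grid_event_constraint (C : nat -> set state) n s :
  grid_event n s ([set w | forall m, (m <= n)%N -> C m (Z m w)] `&` Z n @^-1` [set s]).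
Proof.
elim: n s => [|n IH] s.
  have [Cs|Cs] := pselect (C 0%N s); last first.
    rewrite (_ : _ `&` _ = set0); first exact: grid_event_null.
    by rewrite -subset0 => w [/(_ 0%N isT) /= H Zs]; apply: Cs; rewrite -Zs.
  rewrite (_ : _ `&` _ = Z 0 @^-1` [set s]); first exact: grid_event_initial.
  apply/seteqP; split=> [w []//|w /= Zw]; split=> // m.
  by rewrite leqn0 => /eqP ->; rewrite Zw.
have [Cs|Cs] := pselect (C n.+1 s); last first.
  rewrite (_ : _ `&` _ = set0); first exact: grid_event_null.
  by rewrite -subset0 => w [/(_ n.+1 (leqnn _)) /= H Zs]; apply: Cs; rewrite -Zs.
rewrite (_ : _ `&` _ = \bigcup_s' ([set w | forall m, (m <= n)%N -> C m (Z m w)] `&`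
   Z n @^-1` [set s'] `&` Z n.+1 @^-1` [set s])).
  apply: grid_event_bigcup => [s'|s' s2 s's2]; first exact: (grid_event_step s (IH s')).2.
  rewrite -subset0 => w [[[_ /= Zs'] _] [[_ /= Zs2] _]].
  by move: s's2; rewrite -Zs' -Zs2 eqxx.
apply/seteqP; split=> [w [Cw Zw]|w [s' _ [[Cw _] Zw]]].
  by exists (Z n w) => //; split=> //; split=> // m mn; apply: Cw; exact: leqW.
split=> // m; rewrite leq_eqVlt => /predU1P[->|/Cw//].
by move: Zw => /= ->.
Qed.

Lemma grid_path_measurable n s : measurable (Z n @^-1` [set s]).
Proof.
have := grid_event_measurable (grid_event_constraint (fun=> setT) n s).
by rewrite (_ : mkset _ = setT) ?setTI//; apply/seteqP; split.
Qed.

Lemma grid_event_stateE n s E l : grid_event n s E ->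
  P (E `&` Z n @^-1` [set l]) = (P E * ((s == l)%:R)%:E)%E.
Proof.
have mZ := grid_path_measurable n l.
elim=> [{}E mE EJ|{}E pE|{}E F EF gE PE gF PF].
- have PE0 : P E = 0%E by exact: subset_measure0 EJ J0_alive.
  rewrite PE0 mul0e; apply: (@subset_measure0 _ _ _ P _ E) => //.
  exact: measurableI.
- have ZE w := @path_event_state _ _ _ w pE; have [<-|sl] := eqVneq s l.
    rewrite mule1; congr (P _); apply/seteqP; split=> [w []//|w Ew].
    by split=> //; exact: ZE.
  rewrite mule0 (_ : _ `&` _ = set0) ?measure0// -subset0 => w [/ZE Zw /= Zl].
  by rewrite -Zw Zl eqxx in sl.
have mE := grid_event_measurable gE; have mF := grid_event_measurable gF.
rewrite setIUl; have -> : P (E `|` F) = (P E + P F)%E by exact: measureU.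
rewrite -(fine_probabilityK P mE) -(fine_probabilityK P mF) -EFinD -EFinM mulrDl EFinD !EFinM.
rewrite !fine_probabilityK//.
rewrite -PE -PF; apply: measureU; [exact: measurableI..|].
by rewrite setIACA setIid EF set0I.
Qed.

Lemma grid_event_steps n s E N l : grid_event n s E ->
  P (E `&` Z (n + N) @^-1` [set l]) =
  (P E * ((concat_mx K 1 ^+ N) (enc s) (enc l))%:E)%E.
Proof.
elim: N n s E => [|N IH] n s E gE.
  by rewrite addn0 (grid_event_stateE _ gE) expr0 mxE (inj_eq (@enc_inj _)).
have mE := grid_event_measurable gE.
have mEZ : measurable (E `&` Z (n + N.+1) @^-1` [set l]).
  by apply: measurableI => //; exact: grid_path_measurable.
rewrite (measure_fibers P (f := Z n.+1) mEZ); last first.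
  by move=> s'; apply: measurableI => //; exact: grid_path_measurable.
rewrite exprS mxE sum_enc -(fine_probabilityK P mE) -EFinM mulr_sumr -sumEFin.
apply: eq_bigr => s' _; have [PE gE'] := grid_event_step s' gE.
rewrite setIAC -addSnnS (IH _ _ _ gE') PE concat_mxE -(fine_probabilityK P mE).
by rewrite -!EFinM mulrA.
Qed.

End grid_chain.

(** * The Markov property in continuous time *)

Lemma near_all_mem (T : eqType) (s : seq T) (Q : T -> nat -> Prop) :
  (forall x, x \in s -> \forall n \near \oo, Q x n) ->
  \forall n \near \oo, forall x, x \in s -> Q x n.
Proof.
elim: s => [|y s IH] H; first exact: nearW.
have Hy : \forall n \near \oo, Q y n by apply: H; rewrite mem_head.
have Hs : \forall n \near \oo, forall x, x \in s -> Q x n.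
  by apply: IH => x xs; apply: H; rewrite in_cons xs orbT.
near=> n => x; rewrite in_cons => /predU1P[->|].
  by near: n; exact: Hy.
by move: x; near: n; exact: Hs.
Unshelve. all: by end_near. Qed.

Section concatenated_process.
Context {R : realType} {dsp : measure_display} {Omega : measurableType dsp}.
Variable P : probability Omega R.
Context {p d : nat}.
Variables (J : 'I_d -> R -> Omega -> 'I_(p + 1)) (J0 : Omega -> 'I_(p + 1)).
Variable pt : 'I_d -> R -> 'M[R]_(p + 1).
Variable L : 'I_d -> 'M[R]_(p + 1).
Hypothesis mJ : forall i (t : R) k, 0 <= t -> measurable (J i t @^-1` [set k]).
Hypothesis jJ : forall i w, jump_path (J i ^~ w).
Hypothesis pt_tr : forall i, transition_function (pt i).
Hypothesis pt_L : forall i, has_intensities (pt i) (L i).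
Hypothesis pt_J : forall i, markov_property P (pt i) (J i).
Hypothesis JJ0 : forall i, J i 0 = J0.
Hypothesis Jci : conditionally_independent P J J0.
Hypothesis J0_alive : P (J0 @^-1` [set cemetery p]) = 0%E.
Variable i0 : 'I_d.
Hypothesis L_off : forall i (k l : 'I_(p + 1)), k != l -> 0 <= L i k l.
Hypothesis L_row : forall i k, \sum_l L i k l = 0.

Notation state := (option ('I_d * 'I_p * 'I_p)).

Definition concat_process (t : R) (w : Omega) : state :=
  concat_path (fun i t => J i t w) (J0 w) (enum 'I_d) t.

Let Z := concat_process.
Variable c : R.
Hypothesis c_gt0 : 0 < c.
Hypothesis Lc : row_sum_le (concat_mx L 0) c.
Local Notation h := (grid c).

(** Truncation loses less than one step, so [d.+1] extra steps leave a delay of at least [d], one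
    for each stage. *)
Let N n t : nat := (Num.truncn (t / h n) + d.+1)%N.
Let Zg n m w : state := grid_path (fun i t => J i t w) (J0 w) (enum 'I_d) (h n) m.
Let h0 n : 0 < h n. Proof. exact: grid_gt0. Qed.

Let N_bound n t : 0 <= t ->
  t / h n + d%:R <= (N n t)%:R <= t / h n + d.+1%:R.
Proof.
move=> t0; have /truncn_itv : 0 <= t / h n by rewrite divr_ge0// ltW.
rewrite /N natrD -[_.+1%:R]natr1 -[d.+1%:R]natr1.
by move: (Num.truncn _) => m /andP[m1 m2]; apply/andP; split; lra.
Qed.

Lemma cvg_concat_process t w : 0 <= t ->
  \forall n \near \oo, Zg n (N n t) w = Z t w.
Proof.
move=> t0; have [J0w|J0w] := eqVneq (J0 w) (cemetery p).
  apply: nearW => n; rewrite /Zg /Z /concat_process /grid_path /grid_state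
    /concat_path /alive_state J0w alive_cemetery.
  by case: (clock _ _ _) => [[? ?]|]; case: (iter _ _ _).1.
apply: (@cvg_grid_path _ _ _ _ _ _ _ _ _ _ _ t d.+1%:R) => //.
- by move=> i; rewrite JJ0.
- exact: grid_cvg0.
- move=> n; rewrite size_enum_ord; have /andP[N1 N2] := N_bound n t0.
  rewrite -(ler_pM2r (h0 n)) mulrDl divfK ?gt_eqF// in N1.
  by rewrite -(ler_pM2r (h0 n)) mulrDl divfK ?gt_eqF// in N2; rewrite N1.
Qed.

Definition cylinder (cs : seq (R * state)) : set Omega :=
  [set w | forall x, x \in cs -> Z x.1 w = x.2].

Let grid_cylinder n (cs : seq (R * state)) : set Omega :=
  [set w | forall x, x \in cs -> Zg n (N n x.1) w = x.2].

Let grid_event_cylinder n t cs k :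
  (forall x, x \in cs -> 0 <= x.1 <= t) ->
  grid_event J J0 (h n) (N n t) k
    (grid_cylinder n cs `&` Zg n (N n t) @^-1` [set k]).
Proof.
move=> cst.
(* Several prescribed times may be rounded to the same grid step, so the constraint at step m
   collects all of them. *)
have -> : grid_cylinder n cs = [set w | forall m, (m <= N n t)%N ->
    [set s | forall x, x \in cs -> N n x.1 = m -> s = x.2] (Zg n m w)].
  apply/seteqP; split=> w /= Hw; first by move=> m _ x xcs <-; exact: Hw.
  move=> x xcs; apply: (Hw (N n x.1) _ x xcs erefl).
  have /andP[x0 xt] := cst x xcs.
  by rewrite leq_add2r le_truncn// ler_pM2r// invr_gt0.
exact: (grid_event_constraint mJ pt_J JJ0 Jci J0_alive i0 (ltW (h0 n))
  (fun m => [set s | forall x, x \in cs -> N n x.1 = m -> s = x.2])).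
Qed.

Let grid_cylinder_measurable n cs : measurable (grid_cylinder n cs).
Proof.
rewrite (_ : grid_cylinder n cs =
    \bigcap_(x in [set` cs]) (Zg n (N n x.1) @^-1` [set x.2])); last first.
  by apply/seteqP; split=> w /= Hw x; exact: Hw.
apply: fin_bigcap_measurable => [|x _]; first exact: finite_seq.
exact: (grid_path_measurable mJ pt_J JJ0 Jci J0_alive i0 (ltW (h0 n))).
Qed.

Let cvg_cylinder cs : (forall x, x \in cs -> 0 <= x.1) ->
  measurable (cylinder cs) /\
  fine (P (grid_cylinder n cs)) @[n --> \oo] --> fine (P (cylinder cs)).
Proof.
move=> cs0; apply: cvg_measure_eventually => // w.
have : \forall n \near \oo, forall x, x \in cs -> Zg n (N n x.1) w = Z x.1 w.
  by apply: near_all_mem => x xcs; apply: cvg_concat_process; exact: cs0.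
apply: filterS => n ZE; rewrite /grid_cylinder /cylinder /=.
by split=> H x xcs; [rewrite -ZE|rewrite ZE]; rewrite ?H.
Qed.

Lemma concat_process_measurable t s : 0 <= t -> measurable (Z t @^-1` [set s]).
Proof.
move=> t0; have [|+ _] := @cvg_cylinder [:: (t, s)].
  by move=> x; rewrite inE => /eqP ->.
rewrite (_ : cylinder _ = Z t @^-1` [set s])//.
apply/seteqP; split=> w /=; first by move=> /(_ (t, s)); rewrite mem_head; exact.
by move=> Zw x; rewrite inE => /eqP ->.
Qed.

Let cylinder_cons x cs : cylinder (x :: cs) = cylinder cs `&` Z x.1 @^-1` [set x.2].
Proof.
apply/seteqP; split=> w /=.
  move=> H; split; last by apply: H; rewrite mem_head.
  by move=> y ycs; apply: H; rewrite in_cons ycs orbT.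
by move=> [H Zx] y; rewrite in_cons => /predU1P[->|/H].
Qed.

Let grid_cylinder_cons n x cs : grid_cylinder n (x :: cs) =
  grid_cylinder n cs `&` Zg n (N n x.1) @^-1` [set x.2].
Proof.
apply/seteqP; split=> w /=.
  move=> H; split; last by apply: H; rewrite mem_head.
  by move=> y ycs; apply: H; rewrite in_cons ycs orbT.
by move=> [H Zx] y; rewrite in_cons => /predU1P[->|/H].
Qed.

Let Q n := concat_mx (fun i => pt i (h n)) 1.

Let Q_stochastic n : stochastic (Q n).
Proof.
apply: concat_mx_stochastic => i; have [p0 p1 _ _] := pt_tr i.
by split=> [k l|k]; [apply: p0|apply: p1]; exact: ltW.
Qed.

Let Q_intensity a b : (h n)^-1 * (Q n a b - (a == b)%:R) @[n --> \oo] -->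
  concat_mx L 0 a b.
Proof.
apply: concat_mx_intensity => i k k'.
have /cvg_at_rightP := @pt_L i k k'; apply; split; first exact: h0.
exact: grid_cvg0.
Qed.

Lemma markov_cylinder s t k l cs : 0 <= s -> 0 <= t ->
  (forall x, x \in cs -> 0 <= x.1 <= t) ->
  P (cylinder cs `&` Z t @^-1` [set k] `&` Z (t + s) @^-1` [set l]) =
  (P (cylinder cs `&` Z t @^-1` [set k]) *
   (semigroup (concat_mx L 0) c s (enc k) (enc l))%:E)%E.
Proof.
move=> s0 t0 cst; have ts0 : 0 <= t + s by exact: addr_ge0.
have cs1 x : x \in (t, k) :: cs -> 0 <= x.1.
  by rewrite in_cons => /predU1P[->//|/cst/andP[]].
have cs2 x : x \in (t + s, l) :: (t, k) :: cs -> 0 <= x.1.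
  by rewrite in_cons => /predU1P[->//|/cs1].
have [m1 c1] := cvg_cylinder cs1; have [m2 c2] := cvg_cylinder cs2.
rewrite -[cylinder cs `&` _](cylinder_cons (t, k)).
rewrite -[cylinder _ `&` _](cylinder_cons (t + s, l)).
rewrite -(fine_probabilityK P m1) -(fine_probabilityK P m2) -EFinM; congr (_%:E).
have NN n : (N n t <= N n (t + s))%N.
  by rewrite leq_add2r; apply: le_truncn; rewrite ler_wpM2r ?lerDl// invr_ge0 ltW.
(* The extra [d.+1] steps cancel in the difference, which leaves only rounding. *)
have NK n : `|(N n (t + s) - N n t)%:R - s / h n| <= 1.
  have /andP[] := N_bound n t0; have /andP[] := N_bound n ts0.
  rewrite natrB// ler_norml mulrDl -natr1.
  move: (t / h n) (s / h n) (N n t)%:R (N n (t + s))%:R => a b u v ? ? ? ?.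
  by apply/andP; split; lra.
have cQ := cvg_stochastic_semigroup c_gt0 Lc (concat_mx_off L_off)
  (concat_mx_row0 L_row) s0 Q_stochastic Q_intensity NK.
have E n : fine (P (grid_cylinder n ((t + s, l) :: (t, k) :: cs))) =
    fine (P (grid_cylinder n ((t, k) :: cs))) *
    (Q n ^+ (N n (t + s) - N n t)) (enc k) (enc l).
  apply: EFin_inj; rewrite EFinM !fine_probabilityK// grid_cylinder_cons.
  rewrite grid_cylinder_cons /= -{1}(subnKC (NN n)).
  apply: (grid_event_steps mJ pt_J JJ0 Jci J0_alive i0 (ltW (h0 n))).
  exact: grid_event_cylinder.
move: c2 => /(@cvg_lim _ _ _ _ _) <-//; apply/cvg_lim => //.
rewrite (_ : (fun n => _) = fun n => fine (P (grid_cylinder n ((t, k) :: cs))) *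
    (Q n ^+ (N n (t + s) - N n t)) (enc k) (enc l)); last exact/funext.
by apply: cvgM => //; exact: cQ.
Qed.

(** Cylinders are closed under intersection and generate the past, and the events satisfying the
    identity form a Dynkin class: the pi-lambda theorem extends [markov_cylinder] to the whole
    past. *)
Lemma concat_markov : markov_property P (semigroup (concat_mx L 0) c)
  (fun t w => enc (Z t w)).
Proof.
have encE t k : (fun w => enc (Z t w)) @^-1` [set k] = Z t @^-1` [set dec k].
  apply/seteqP; split=> w /=; first by move=> <-; rewrite encK.
  by move=> ->; rewrite decK.
move=> s t k l A s0 t0 HA; rewrite !encE -{3}[k]decK -{2}[l]decK.
set q := semigroup _ _ _ _ _; set C := Z t @^-1` _; set D := Z (t + s) @^-1` _.
have mC : measurable C by exact: concat_process_measurable.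
have mD : measurable D by apply: concat_process_measurable; exact: addr_ge0.
pose G := [set B | exists2 cs, (forall x, x \in cs -> 0 <= x.1 <= t) & B = cylinder cs].
pose H := [set B | measurable B /\ P (B `&` C `&` D) = (P (B `&` C) * q%:E)%E].
suff GH : <<s G >> `<=` H.
  suff /GH[] : <<s G >> A by [].
  apply: sub_sigma_algebra2 HA => _ [u [m [ut ->]]]; rewrite encE.
  exists [:: (u, dec m)].
    by move=> x; rewrite inE => /eqP -> /=; rewrite /= in_itv in ut.
  apply/seteqP; split=> w /=; first by move=> Zw x; rewrite inE => /eqP ->.
  by move=> /(_ (u, dec m)); rewrite mem_head; exact.
have GI : setI_closed G.
  move=> _ _ [c1 H1 ->] [c2 H2 ->]; exists (c1 ++ c2).
    by move=> x; rewrite mem_cat => /orP[/H1|/H2].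
  apply/seteqP; split=> w /=.
    by move=> [E1 E2] x; rewrite mem_cat => /orP[/E1|/E2].
  by move=> E; split=> x xc; apply: E; rewrite mem_cat xc ?orbT.
have GsubH : G `<=` H.
  move=> _ [cs cst ->]; split; last exact: markov_cylinder.
  by have [|//] := @cvg_cylinder cs; move=> x /cst/andP[].
rewrite -(setI_closed_g_dynkin_g_sigma_algebra GI); apply: smallest_sub => //.
have [HT1 HT2] : H setT.
  by apply: GsubH; exists [::] => //; apply/seteqP; split.
split=> //.
- move=> B [mB HB]; split; first exact: measurableC.
  rewrite !setTI in HT2.
  have mCD : measurable (C `&` D) by exact: measurableI.
  have mBC : measurable (B `&` C) by exact: measurableI.
  have -> : P (~` B `&` C `&` D) = (P (C `&` D) - P (B `&` C `&` D))%E.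
    rewrite -setIA setIC -setDE measureD//; last by rewrite ltey_eq fin_num_measure.
    by rewrite [_ `&` B]setIC setIA.
  have -> : P (~` B `&` C) = (P C - P (B `&` C))%E.
    rewrite setIC -setDE measureD//; last by rewrite ltey_eq fin_num_measure.
    by rewrite [_ `&` B]setIC.
  rewrite HT2 HB -(fine_probabilityK P mC) -(fine_probabilityK P mBC).
  by rewrite -[X in _ = (X * _)%E]EFinB -!EFinM -EFinB mulrBl.
- move=> F tF FH; split; first by apply: bigcupT_measurable => n; exact: (FH n).1.
  have mF n : measurable (F n `&` C) by apply: measurableI => //; exact: (FH n).1.
  have tFC E : trivIset setT (fun n => F n `&` E).
    apply/trivIsetP => m n _ _ mn; rewrite setIACA.
    by have /trivIsetP -> := tF; rewrite ?set0I.
  rewrite !setI_bigcupl measure_bigcup//; first last.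
  - rewrite (_ : (fun _ => _) = fun n => F n `&` (C `&` D))//.
    by apply/funext => n; rewrite setIA.
  - by move=> n _; exact: measurableI.
  rewrite measure_bigcup// muleC -nneseriesZl//.
  by apply: eq_eseriesr => n _; rewrite muleC; exact: (FH n).2.
Qed.

End concatenated_process.

(** * Rewards *)

Section rewards.
Context {R : realType}.

(** On each grid cell the value at the right endpoint is used; by right-continuity it is the value
    at t once the mesh is small, so countable unions of intervals eventually decide membership. *)
Lemma right_const_measurable (T : eqType) (x : R -> T) (k : T) :
  (forall t, 0 <= t -> right_const x t) ->
  measurable (`[0%R, +oo[ `&` x @^-1` [set k]).
Proof.
move=> xr; set D := [set` `[0%R, +oo[]; pose h := @grid R 1.
have h0 n : 0 < h n by exact: grid_gt0.
pose cell n m : set R := [set` `[m%:R * h n, m.+1%:R * h n[ ].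
pose A n := \bigcup_(m in [set m | x (m.+1%:R * h n) = k]) cell n m.
apply: (@measurable_eventually _ _ A).
  move=> n; apply: bigcup_measurable => m _; exact: measurable_itv.
move=> t; have [t0|t0] := ltP t 0.
  apply: nearW => n; split=> [[m _]|[]]; rewrite /cell/D/= !in_itv/=.
    by move=> /andP[mt _]; have := le_lt_trans mt t0; rewrite ltNge mulr_ge0// ltW.
  by rewrite andbT leNgt t0.
have [e e0 xe] := xr t t0.
have small : \forall n \near \oo, h n < e.
  by have := @grid_cvg0 R 1 => /cvgr_lt; apply.
near=> n.
have he : h n < e by near: n; exact: small.
have /truncn_itv : 0 <= t / h n by rewrite divr_ge0// ltW.
rewrite ler_pdivlMr// ltr_pdivrMr//; set m := Num.truncn _ => /andP[mt tm].
have xm : x (m.+1%:R * h n) = x t.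
  apply: xe; first exact: ltW.
  by rewrite -natr1 mulrDl mul1r ler_ltD.
split=> [[m' /= xm']|[_ /= xt]].
  rewrite /cell /= in_itv/= => /andP[m't tm'].
  have mm' : m' = m.
    have := le_lt_trans m't tm; rewrite ltr_pM2r// ltr_nat ltnS => m'm.
    have := le_lt_trans mt tm'; rewrite ltr_pM2r// ltr_nat ltnS => mm'.
    by apply/eqP; rewrite eqn_leq m'm.
  split; first by rewrite /D /= in_itv/= t0.
  by rewrite -xm -mm'.
exists m; first by rewrite /= xm.
by rewrite /cell /= in_itv/= mt.
Unshelve. all: by end_near. Qed.

Lemma total_reward_itv q d (r : 'M[R]_(q, d)) (x : R -> 'I_(q + 1)) j (S u : R) :
  (forall t, 0 <= t -> right_const x t) -> (forall k, 0 <= r k j) ->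
  0 <= S -> 0 < u ->
  (forall t, 0 <= t ->
    \sum_k r k j * (x t == lshift 1 k)%:R = (S <= t < S + u)%R%:R) ->
  total_reward r x j = u%:E.
Proof.
move=> xr r0 S0 u0 rS; rewrite /total_reward /occupation_time.
have mI k : measurable_fun ([set` `[0%R, +oo[] : set R)
    (fun t : R => (\1_(x @^-1` [set k]) t)%:E : \bar R).
  apply/measurable_EFinP.
  apply: (eq_measurable_fun
    (\1_([set` `[0%R, +oo[] `&` x @^-1` [set k]) : R -> R)).
    by move=> t tD; rewrite !indicE in_setI tD.
  by apply: measurable_indic; exact: right_const_measurable.
transitivity (\int[lebesgue_measure]_(t in `[0%R, +oo[)
    (\1_(`[S, S + u[ : set R) t : R)%:E)%E.
  under eq_bigr => k _.
    rewrite -ge0_integralZl_EFin//; last exact: (mI (lshift 1 k)).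
    over.
  rewrite -ge0_integral_sum//; last 2 first.
  - by move=> k; apply: measurable_funeM; exact: (mI (lshift 1 k)).
  - by move=> k t _; rewrite mule_ge0 ?lee_fin.
  apply: eq_integral => t; rewrite inE /= in_itv/= andbT => t0.
  under eq_bigr do rewrite -EFinM.
  rewrite sumEFin; congr (_%:E); rewrite indicE mem_setE in_itv/= -rS//.
  apply: eq_bigr => k _; congr (_ * _); rewrite indicE; congr (_%:R).
  by congr (nat_of_bool _); apply/idP/eqP; rewrite inE.
rewrite integral_indic// (setIidl _); last first.
  by move=> t /=; rewrite !in_itv/= andbT => /andP[/(le_trans S0)].
apply: (etrans (lebesgue_measure_itv `[S, (S + u)[)).
by rewrite /= lte_fin ltrDl u0 -EFinB addrAC subrr add0r.
Qed.

End rewards.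

Section absorbed_intensity_theory.
Context {R : realType} {p : nat} (T : 'M[R]_p).
Hypothesis hT : sub_intensity T.

Lemma absorbed_intensity_off k l : k != l -> 0 <= absorbed_intensity T k l.
Proof.
have [T0 _ Trow] := hT; rewrite /absorbed_intensity.
case: (split_ordP k) => k' ->; last by rewrite col_mxEd row_mx0 mxE.
case: (split_ordP l) => l' ->.
  by rewrite block_mxEul (inj_eq (@lshift_inj _ _)) => /T0.
move=> _; rewrite block_mxEur !mxE oppr_ge0.
by under eq_bigr do rewrite mxE mulr1.
Qed.

Lemma absorbed_intensity_row k : \sum_l absorbed_intensity T k l = 0.
Proof.
rewrite /absorbed_intensity big_split_ord big_ord1 /=.
case: (split_ordP k) => k' ->.
  under eq_bigr do rewrite block_mxEul.
  rewrite block_mxEur !mxE; under [X in - X]eq_bigr do rewrite mxE mulr1.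
  by rewrite subrr.
by rewrite block_mxEdr mxE big1 ?addr0// => l _; rewrite block_mxEdl mxE.
Qed.

Lemma absorbed_intensity_diag (k : 'I_p) :
  absorbed_intensity T (lshift 1 k) (lshift 1 k) != 0.
Proof.
by have [_ Td _] := hT; rewrite /absorbed_intensity block_mxEul lt_eqF.
Qed.

Lemma absorbed_intensity_absorbing : absorbing (absorbed_intensity T) (cemetery p).
Proof. by move=> l; rewrite /absorbed_intensity col_mxEd row_mx0 mxE. Qed.

End absorbed_intensity_theory.

(** * Rewards earned along the concatenated path *)

Section concatenated_rewards.
Context {R : realType} {p d : nat}.
Variable (x : 'I_d -> R -> 'I_(p + 1)) (j0 : 'I_(p + 1)).
Hypothesis jx : forall i, jump_path (x i).
Hypothesis x0 : forall i, x i 0 = j0.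
Notation triple := ('I_d * 'I_p * 'I_p)%type.

(** Rate 1 in component [i] exactly while stage [i] runs makes the total reward the duration of that
    stage. *)
Definition stage_reward : 'M[R]_(#|{: triple}|, d) :=
  \matrix_(k, i) (in_stage i (Some (enum_val k)))%:R.

Let path t := enc (concat_path x j0 (enum 'I_d) t).

Let concat_path_dead t : j0 = cemetery p -> concat_path x j0 (enum 'I_d) t = None.
Proof.
move=> ->; rewrite /concat_path /alive_state alive_cemetery.
by case: (clock _ _ _) => [[]|].
Qed.

Lemma enc_concat_path_right t : 0 <= t -> right_const path t.
Proof.
move=> t0; have [/concat_path_dead H|j0a] := eqVneq j0 (cemetery p).
  by exists 1 => // s _ _; rewrite /path !H.
have [e e0 He] := concat_path_right jx x0 j0a (enum 'I_d) t0.
by exists e => // s ts se; rewrite /path He.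
Qed.

Lemma concat_path_jump : jump_path path.
Proof.
split=> [t t0|t t0]; first exact/right_constP/enc_concat_path_right.
apply/left_constP; have [/concat_path_dead H|j0a] := eqVneq j0 (cemetery p).
  by exists 1 => //; exists (enc None) => s _ _; rewrite /path !H.
have [e e0 [k He]] := concat_path_left jx x0 j0a (enum 'I_d) t0.
by exists e => //; exists (enc k) => s ts se; rewrite /path He.
Qed.

Lemma concat_path_reward i u : j0 != cemetery p ->
  (forall i', absorption_time (x i') \is a fin_num) ->
  absorption_time (x i) = u%:E -> total_reward stage_reward path i = u%:E.
Proof.
move=> j0a xfin xu; have x0a : x i 0 != cemetery p by rewrite x0.
have [u0 _] := absorption_time_fin (jx i) x0a xu.
have [|||S S0 HS] :=
  @concat_path_stage _ _ _ x j0 jx x0 j0a (enum 'I_d) i u _ _ _ xu.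
- by move=> i' _.
- exact: enum_uniq.
- exact: mem_enum.
apply: (total_reward_itv (S := S)) => //.
- by move=> t t0; exact: enc_concat_path_right.
- by move=> k; rewrite mxE.
move=> t t0; rewrite -HS// /path; case: (concat_path _ _ _ _) => [y|]; last first.
  by apply: big1 => k _; rewrite eq_rlshift mulr0.
rewrite (bigD1 (enum_rank y))//= mxE enum_rankK eqxx mulr1 big1 ?addr0// => k ky.
by rewrite (inj_eq (@lshift_inj _ _)) eq_sym (negPf ky) mulr0.
Qed.

(** The first stage starts alive unless [j0] is dead, so the concatenated process starts in the
    cemetery only on a null event. *)
Lemma concat_path0 : (0 < d)%N -> concat_path x j0 (enum 'I_d) 0 = None ->
  j0 = cemetery p.
Proof.
move=> d0 H; apply/eqP; apply: contraTT isT => j0a; move: H.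
case E : (enum 'I_d) => [|i r].
  by have := size_enum_ord d; rewrite E => /esym d00; rewrite d00 in d0.
rewrite concat_path_cons_lt; last by apply: absorption_time_gt0; rewrite ?x0.
by rewrite x0 /alive_state; case: (aliveP j0) j0a.
Qed.

End concatenated_rewards.

Section almost_sure_start.
Context {R : realType} {dsp : measure_display} {Omega : measurableType dsp}.
Variable P : probability Omega R.

Lemma cemetery_start0 p (J0 : Omega -> 'I_(p + 1)) (a : 'rV[R]_p) :
  (forall k, measurable (J0 @^-1` [set k])) ->
  (forall k, P (J0 @^-1` [set lshift 1 k]) = (a ord0 k)%:E) ->
  \sum_k a ord0 k = 1 -> P (J0 @^-1` [set cemetery p]) = 0%E.
Proof.
move=> mJ0 PJ a1.
have := @measure_fibers _ _ _ P _ J0 setT measurableT.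
rewrite (@probability_setT _ _ _ P) big_split_ord big_ord1 /= => H.
have {}H := H (fun s => measurableI _ _ measurableT (mJ0 s)).
rewrite setTI in H; move: H.
under eq_bigr do rewrite setTI PJ.
rewrite sumEFin a1 -(fine_probabilityK P (mJ0 _)) -EFinD => -[H]; congr (_%:E).
by move: H; rewrite -/(cemetery p); lra.
Qed.

Lemma probability_ae (A : set Omega) : measurable A ->
  {ae P, forall w, A w} -> P A = 1%E.
Proof.
move=> mA [N [mN PN AN]].
rewrite -(setCK A) probability_setC; last exact: measurableC.
rewrite (_ : P (~` A) = 0%E) ?sube0//.
by apply: (subset_measure0 _ mN) PN; [exact: measurableC|exact: AN].
Qed.

End almost_sure_start.

Theorem proposition2p2 (R : realType) (d p : nat) (hd : (0 < d)%N)
    (hp : (0 < p)%N) (a : 'rV[R]_p) (T : 'I_d -> 'M[R]_p)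
    (dsp : measure_display) (Omega : measurableType dsp)
    (P : probability Omega R) (X : {RV P >-> d.-tuple R})
    (hX : mPH a T (distribution P X)) :
  MPHstar (distribution P X) /\
  distribution P X [set x : d.-tuple R | forall i, 0 < tnth x i] = 1%E.
Proof.
case: (hX) => -[_ a1] hT Ttr [dsp' [Om [P' [J [J0 [Y [HJ [JJ0 PJ0] Jci HY HB]]]]]]].
pose i0 := Ordinal hd.
have mJ i (t : R) k : 0 <= t -> measurable (J i t @^-1` [set k]).
  by have [H _ _] := HJ i; exact: H.
have jJ i w : jump_path (J i ^~ w) by have [_ H _] := HJ i; exact: H.
have [pt Hpt] := choice (fun i => let: And3 _ _ E := HJ i in E).
have J0_alive : P' (J0 @^-1` [set cemetery p]) = 0%E.
  apply: cemetery_start0 PJ0 a1 => k; rewrite -(JJ0 i0); exact: mJ.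
have aeJ0 : {ae P', forall w, J0 w != cemetery p}.
  exists (J0 @^-1` [set cemetery p]); split=> //.
    by rewrite -(JJ0 i0); exact: mJ.
  by move=> w /= /negP; rewrite negbK => /eqP.
pose L i := absorbed_intensity (T i).
have L_off i (k l : 'I_(p + 1)) : k != l -> 0 <= L i k l.
  by apply: absorbed_intensity_off.
have L_row i k : \sum_l L i k l = 0 by exact: absorbed_intensity_row.
have L_diag i (k : 'I_p) : L i (lshift 1 k) (lshift 1 k) != 0.
  exact: absorbed_intensity_diag.
have L_abs i : absorbing (L i) (cemetery p) by exact: absorbed_intensity_absorbing.
have pt_tr i : transition_function (pt i) by have [] := Hpt i.
have pt_L i : has_intensities (pt i) (L i) by have [] := Hpt i.
have pt_J i : markov_property P' (pt i) (J i) by have [] := Hpt i.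
have x0 w i : J i 0 w = J0 w by rewrite JJ0.
have [c c0 Lc] := row_sum_le_exists (concat_mx L 0).
pose Z t w := enc (concat_process J J0 t w).
have mY : measurable [set x : d.-tuple R | forall i, 0 < tnth x i].
  rewrite (_ : mkset _ = \bigcap_i ((fun x : d.-tuple R => tnth x i) @^-1` `]0, +oo[)).
    apply: fin_bigcap_measurable => [|i _]; first exact: finite_finset.
    rewrite -[X in measurable X]setTI; apply: measurable_tnth => //.
  apply/seteqP; split=> x /= Hx i; first by move=> _; rewrite /= in_itv/= Hx.
  by have := Hx i I; rewrite /= in_itv/= andbT.
split; last first.
  (* [X] enters only through its law, so positivity is checked for [Y]: a right-continuous path
     started outside the cemetery needs a positive time to reach it. *)
  rewrite HB//.
  have : P' (Y @^-1` [set x : d.-tuple R | forall i, 0 < tnth x i]) = 1%E; last exact.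
  apply: probability_ae.
    by rewrite -[X in measurable X]setTI; exact: (measurable_funPT Y measurableT _ mY).
  move: aeJ0 HY; apply: filterS2 => w J0w Yw i.
  rewrite -lte_fin Yw; apply: absorption_time_gt0 => //.
  by rewrite x0.
exists #|{: 'I_d * 'I_p * 'I_p}|, (concat_mx L 0), stage_reward, dsp', Om, P', Z, Y.
split=> //.
- split; last by move=> k j; rewrite mxE.
  by rewrite !card_prod !card_ord !muln_gt0 hd hp.
- split; last exact: absorbing_concat.
  move=> k; rewrite -[k]enum_valK; case: (enum_val k) => -[i j] k'.
  exact: (transient_concat L_diag L_abs j (Ttr i k')).
- split.
    split.
    + move=> t k t0; rewrite (_ : _ @^-1` _ = concat_process J J0 t @^-1` [set dec k]).
        exact: (concat_process_measurable mJ jJ pt_J JJ0 Jci J0_alive i0 c0).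
      apply/seteqP; split=> w; rewrite /Z /=; first by move=> <-; rewrite encK.
      by move=> ->; rewrite decK.
    + by move=> w; apply: concat_path_jump => //.
    + exists (semigroup (concat_mx L 0) c); split.
      * exact: (semigroup_transition c0 Lc (concat_mx_off L_off)
          (concat_mx_row0 L_row)).
      * exact: (semigroup_intensities c0 Lc (concat_mx_off L_off)
          (concat_mx_row0 L_row)).
      * exact: (concat_markov mJ jJ pt_tr pt_L pt_J JJ0 Jci J0_alive i0 L_off
          L_row c0 Lc).
  apply: subset_measure0 (J0_alive).
  + rewrite (_ : _ @^-1` _ = concat_process J J0 0 @^-1` [set None]).
      exact: (concat_process_measurable mJ jJ pt_J JJ0 Jci J0_alive i0 c0).
    apply/seteqP; split=> w; rewrite /Z /=; last by move=> ->.
    by move=> /(@enc_inj _ _ None).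
  + by rewrite -(JJ0 i0); exact: mJ.
  + move=> w /= /(@enc_inj _ _ None); exact: concat_path0 (hd).
- move: aeJ0 HY; apply: filterS2 => w J0w Yw j.
  (* The absorption times equal the real entries of [Y], so every stage is reached and ends. *)
  have fin i : absorption_time (fun t => J i t w) \is a fin_num by rewrite -Yw.
  by rewrite (concat_path_reward _ _ J0w fin (esym (Yw j))).
Qed.
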